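(* Let $\alpha>0$, $\beta>0$ and $0<a<1$. The law of the $a$-remainder of the gamma law $\Gamma(\alpha,\beta)$ is an infinite mixture, with Polya weights $\overline{\mathfrak{B}}(\alpha,1-a)$, of the Erlang laws $\mathfrak{E}_k(\beta/a)$, $k=0,1,2,\dots$, with characteristic function $$\chi_a(u,\alpha,\beta)=\sum_{k=0}^\infty\binom{\alpha+k-1}{k}a^\alpha(1-a)^k\left(\frac{\beta}{\beta-iau}\right)^k$$ and (generalized) density $$g_a(x,\alpha,\beta)=a^\alpha\delta(x)+\sum_{k=1}^\infty\binom{\alpha+k-1}{k}a^\alpha(1-a)^k f_{k,\beta/a}(x),$$ where the absolutely continuous part is supported on $x>0$.
   Context: $\Gamma(\alpha,\beta)$ ($\alpha,\beta>0$) is the gamma law with density $f_{\alpha,\beta}(x)=\frac{\beta}{\Gamma(\alpha)}(\beta x)^{\alpha-1}e^{-\beta x}$ for $x>0$ (and $0$ otherwise) and characteristic function $\varphi_{\alpha,\beta}(u)=\left(\frac{\beta}{\beta-iu}\right)^\alpha$. It is self-decomposable: for every $0<a<1$ there is a probability law, called the law of the $a$-remainder $Z_a$, with characteristic function $\chi_a$ such that $\varphi_{\alpha,\beta}(u)=\varphi_{\alpha,\beta}(au)\chi_a(u)$, that is $\chi_a(u)=\left(\frac{\beta-iau}{\beta-iu}\right)^\alpha$. For $k=1,2,\dots$ the Erlang law is $\mathfrak{E}_k(\beta)=\Gamma(k,\beta)$; $\mathfrak{E}_0(\beta)$ is the law degenerate at $0$. The Polya (negative binomial) law $\overline{\mathfrak{B}}(\alpha,p)$,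 $\alpha>0$, $0<p<1$, gives mass $\binom{\alpha+k-1}{k}(1-p)^\alpha p^k$ to $k=0,1,2,\dots$, where $\binom{\alpha+k-1}{k}=\frac{\alpha(\alpha+1)\cdots(\alpha+k-1)}{k!}$. $\delta$ is the Dirac delta at $0$, so a density containing a term $c\,\delta(x)$ denotes a law with an atom of mass $c$ at $0$. *)

(* Defs.v *)
From HB Require Import structures.
From mathcomp Require Import all_boot all_order all_algebra.
From mathcomp Require Import all_classical all_reals all_analysis measurable_realfun.
From mathcomp Require Import complex.

Set Implicit Arguments.
Unset Strict Implicit.
Unset Printing Implicit Defensive.

Import Order.TTheory GRing.Theory Num.Theory.
Import numFieldNormedType.Exports.

Local Open Scope classical_set_scope.
Local Open Scope ring_scope.

Section gamma_law.
Context {R : realType}.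
Implicit Types alpha beta : R.

Definition Gamma alpha : R :=
  \int[lebesgue_measure]_(x in `]0, +oo[) (x `^ (alpha - 1) * expR (- x)).

(* Extended by 0 to parameters that are not both positive, so that
   [gamma_law] below is a measure for all real parameters. *)
Definition gamma_pdf alpha beta (x : R) : R :=
  if [&& 0 < alpha, 0 < beta & 0 < x] then
    beta / Gamma alpha * (beta * x) `^ (alpha - 1) * expR (- (beta * x))
  else 0.

Lemma Gamma_ge0 alpha : 0 <= Gamma alpha.
Proof.
by apply: fine_ge0; apply: integral_ge0 => x _;
  rewrite lee_fin mulr_ge0 ?powR_ge0 ?expR_ge0.
Qed.

Lemma gamma_pdf_ge0 alpha beta x : 0 <= gamma_pdf alpha beta x.
Proof.
rewrite /gamma_pdf; case: ifP => // /and3P[_ b0 _].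
by rewrite mulr_ge0 ?expR_ge0// mulr_ge0 ?powR_ge0// divr_ge0 ?Gamma_ge0 ?ltW.
Qed.

Lemma measurable_gamma_pdf alpha beta :
  measurable_fun [set: R] (gamma_pdf alpha beta).
Proof.
apply: measurable_fun_if => //.
  apply: measurable_and => //; apply: measurable_and => //.
  exact: measurable_fun_ltr.
apply: measurable_funTS; apply: measurable_funM; last first.
  apply: measurableT_comp => //; apply: measurableT_comp => //.
apply: measurable_funM => //.
apply: (measurableT_comp (measurable_powR _)) => //.
Qed.

Definition gamma_law alpha beta (A : set R) : \bar R :=
  (\int[lebesgue_measure]_(x in A) (gamma_pdf alpha beta x)%:E)%E.

Lemma gamma_law0 alpha beta : gamma_law alpha beta set0 = 0%E.
Proof. by rewrite /gamma_law integral_set0. Qed.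

Lemma gamma_law_ge0 alpha beta A : (0 <= gamma_law alpha beta A)%E.
Proof. by apply: integral_ge0 => x _; rewrite lee_fin gamma_pdf_ge0. Qed.

Lemma gamma_law_sigma_additive alpha beta :
  semi_sigma_additive (gamma_law alpha beta).
Proof.
move=> /= F mF tF mUF; rewrite /gamma_law ge0_integral_bigcup//=; last 2 first.
- by apply/measurable_EFinP; apply: measurable_funTS;
    exact: measurable_gamma_pdf.
- by move=> x _; rewrite lee_fin gamma_pdf_ge0.
apply: is_cvg_ereal_nneg_natsum_cond => n _ _.
by apply: integral_ge0 => /= x _; rewrite lee_fin gamma_pdf_ge0.
Qed.

HB.instance Definition _ alpha beta := isMeasure.Build _ _ _
  (gamma_law alpha beta) (gamma_law0 alpha beta) (gamma_law_ge0 alpha beta)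
  (@gamma_law_sigma_additive alpha beta).

Definition erlang (k : nat) beta : {measure set R -> \bar R} :=
  if k is 0 then dirac (0 : R) else gamma_law k%:R beta.

End gamma_law.

Section polya.
Context {R : realType}.

(* alpha (alpha + 1) ... (alpha + k - 1) / k!, the binomial coefficient
   "alpha + k - 1 choose k" with real upper argument *)
Definition polya_binom (alpha : R) (k : nat) : R :=
  (\prod_(i < k) (alpha + i%:R)) / (k`!)%:R.

Definition polya_pmf (alpha p : R) (k : nat) : R :=
  polya_binom alpha k * (1 - p) `^ alpha * p ^+ k.

End polya.

Section laws.
Context {R : realType}.
Implicit Types mu nu : {measure set R -> \bar R}.

Definition is_mixture (w : nat -> R) (K : nat -> {measure set R -> \bar R})
    nu : Prop :=
  forall A : set R, measurable A ->
    nu A = (\sum_(0 <= k <oo) ((w k)%:E * K k A))%E.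

(* E[e^{iuX}] for X of law mu, the integral being taken componentwise *)
Definition char_fun mu (u : R) : R[i] :=
  ((\int[mu]_x cos (u * x)) +i* (\int[mu]_x sin (u * x)))%C.

Definition is_remainder (a : R) mu nu : Prop :=
  forall u : R, char_fun mu u = char_fun mu (a * u) * char_fun nu u.

(* nu has the generalized density c * delta(x) + g x. *)
Definition has_generalized_density nu (c : R) (g : R -> R) : Prop :=
  [/\ measurable_fun [set: R] g,
      forall x, 0 <= g x &
      forall A : set R, measurable A ->
        nu A = (c%:E * \d_(0 : R)%R A
                + \int[lebesgue_measure]_(x in A) (g x)%:E)%E].

End laws.

(* Main.v *)
(* Write [b = beta / a] and let [w k] be the Polya weights.  Summing the
   exponential series gives the identity of densities
   [f_(alpha, beta) = \sum_k w k * f_(alpha + k, b)].  Integration by parts gives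
   [phi_(alpha + 1, b) u = b / (b - i u) * phi_(alpha, b) u] for the gamma
   characteristic functions, and by scaling
   [phi_(alpha, b) u = phi_(alpha, beta) (a u)].  Hence
   [phi_(alpha, beta) u = phi_(alpha, beta) (a u) * \sum_k w k (b / (b - i u)) ^ k]:
   the mixture of Erlang laws is an [a]-remainder.  It is the only one because
   [phi_(alpha, beta)] has no zero, so that the characteristic function of a
   remainder is determined, and because a law is determined by its
   characteristic function.  For the latter, Abel means of the characteristic
   function give the Poisson integrals of the law, whose primitives are
   differences of arctangents converging to interval indicators. *)

From HB Require Import structures.
Require Import Defs.
From mathcomp Require Import all_boot all_order all_algebra.
From mathcomp Require Import all_classical all_reals all_analysis.
From mathcomp Require Import complex.
From mathcomp Require Import measurable_realfun ring lra.

Set Implicit Arguments.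
Unset Strict Implicit.
Unset Printing Implicit Defensive.

Import Order.TTheory GRing.Theory Num.Theory.
Import numFieldNormedType.Exports.

Local Open Scope classical_set_scope.
Local Open Scope ring_scope.

(** * Improper integrals and scaling *)

(** The closed form of the gamma characteristic function involves complex powers with a real
    exponent. Only its behaviour under scaling and under integer shifts of the shape is used, so the
    analysis stays with real integrals of cosines and sines. The price is that the absence of zeros
    cannot be read off a formula: it is derived from the existence of remainders, for an auxiliary
    ratio. The identity of densities rests on [e^(-beta x) = e^(-b x) e^((1 - a) b x)], which holds
    as [a b = beta]; expanding the second factor raises the shape by [k] in the [k]-th term.
    Summation under the integral and Tonelli are applied to nonnegative integrands, so a function
    [h] with values in [[-1, 1]] enters as [1 + h] and the constant is subtracted afterwards. *)

Section improper_integrals.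
Context {R : realType}.
Local Notation mu := (@lebesgue_measure R).
Implicit Types f F : R -> R.

Lemma measurable_fun_continuous_oy f :
  (forall x, 0 < x -> {for x, continuous f}) -> measurable_fun `](0 : R), +oo[ f.
Proof.
move=> cf; apply: open_continuous_measurable_fun => //.
by move=> x; rewrite inE/= in_itv/= andbT => /cf.
Qed.

Lemma bigcup_invn_oy :
  \bigcup_n `[(n.+1%:R)^-1, +oo[%classic = `]0, +oo[%classic :> set R.
Proof.
apply/seteqP; split => x /=.
  move=> [n _]/=; rewrite !in_itv/= !andbT; apply: lt_le_trans.
  by rewrite invr_gt0.
rewrite in_itv/= andbT => x0; exists (Num.truncn x^-1) => //=.
rewrite in_itv/= andbT -[leRHS]invrK lef_pV2 ?posrE ?invr_gt0//.
by rewrite ltW// truncnS_gt.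
Qed.

Lemma cvg_invn_right0 F (l : R) : F x @[x --> 0^'+] --> l ->
  F (n.+1%:R)^-1 @[n --> \oo] --> l.
Proof.
move=> /cvg_at_rightP; apply; split => //.
have := @cvg_harmonic R; exact.
Qed.

(** [f] may be singular at 0, as [x^(p-1)] is for [p < 1]. The fundamental theorem is applied on the
    half-lines starting at [1/(n+1)], and monotone convergence lets them grow to the open
    half-line. *)
Lemma ge0_FTC_oy f F (l0 l : R) :
  (forall x, 0 < x -> 0 <= f x) ->
  (forall x, 0 < x -> {for x, continuous f}) ->
  (forall x : R, 0 < x -> is_derive x 1 F (f x)) ->
  F x @[x --> 0^'+] --> l0 -> F x @[x --> +oo] --> l ->
  (\int[mu]_(x in `]0%R, +oo[) (f x)%:E = (l - l0)%:E)%E.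
Proof.
move=> f0 cf dF F0 Fy.
have vpos n : 0 < (n.+1%:R : R)^-1 by rewrite invr_gt0.
have cvg1 : (\int[mu]_(x in `[((n.+1)%:R)^-1%R, +oo[) (f x)%:E @[n --> \oo] -->
    \int[mu]_(x in `]0%R, +oo[) (f x)%:E)%E.
  rewrite -bigcup_invn_oy.
  have H := @ge0_nondecreasing_set_cvg_integral _ (measurableTypeR R) R
    (fun n => `[(n.+1%:R : R)^-1, +oo[%classic) (EFin \o f) mu.
  apply: H => //=.
  - apply/nondecreasing_seqP => n; apply/subsetPset => x /=.
    rewrite !in_itv/= !andbT; apply: le_trans.
    by rewrite lef_pV2 ?posrE// ler_nat.
  - move=> n; apply/measurable_EFinP.
    apply: measurable_funS (measurable_fun_continuous_oy cf) => //.
    move=> x /=; rewrite !in_itv/= !andbT; exact: lt_le_trans.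
  - move=> n x; rewrite /= in_itv/= andbT => nx.
    by rewrite lee_fin f0// (lt_le_trans _ nx).
have cvg2 : (\int[mu]_(x in `[((n.+1)%:R)^-1%R, +oo[) (f x)%:E @[n --> \oo] -->
    (l - l0)%:E)%E.
  have dF' x : 0 < x -> derivable F x 1 by move=> /dF [].
  rewrite [X in X @ _ --> _](_ : _ = fun n => (l - F (n.+1%:R)^-1)%:E).
    apply: cvg_EFin; first exact: nearW.
    by apply: cvgB; [exact: cvg_cst|exact: cvg_invn_right0].
  apply/funext => n; rewrite EFinB; apply: ge0_continuous_FTC2y => //.
  - by move=> x nx; rewrite f0// (lt_le_trans _ nx).
  - apply/continuous_within_itvcyP; split.
      move=> x; rewrite in_itv/= andbT => nx; apply: cf.
      by rewrite (lt_trans _ nx).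
    by apply: cvg_at_right_filter; exact: cf.
  - by move=> x nx; apply: dF'; rewrite (lt_trans _ nx).
  - apply: cvg_at_right_filter.
    by apply/differentiable_continuous/derivable1_diffP/dF'.
  - move=> x; rewrite in_itv/= andbT => nx; rewrite derive1E.
    by have [_ ->] := dF _ (lt_trans (vpos n) nx).
exact: cvg_unique cvg1 cvg2.
Qed.

(** For an integrand without constant sign, dominated convergence with majorant [|f|] replaces
    monotone convergence, along an exhaustion by compact intervals. *)
Lemma integrable_FTC_oy f F (l0 l : R) :
  mu.-integrable `](0 : R), +oo[ (EFin \o f) ->
  (forall x, 0 < x -> {for x, continuous f}) ->
  (forall x : R, 0 < x -> is_derive x 1 F (f x)) ->
  F x @[x --> 0^'+] --> l0 -> F x @[x --> +oo] --> l ->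
  (\int[mu]_(x in `]0%R, +oo[) (f x)%:E = (l - l0)%:E)%E.
Proof.
move=> intf cf dF F0 Fy.
have vpos n : 0 < (n.+1%:R : R)^-1 by rewrite invr_gt0.
(* The right end is [n + 2] so that the interval is nondegenerate already for [n = 0]. *)
pose I n : set R := `[(n.+1%:R)^-1, n.+2%:R]%classic.
have Ipos n x : I n x -> 0 < x.
  by rewrite /I/= in_itv/= => /andP[+ _]; exact: lt_le_trans.
have mf := measurable_fun_continuous_oy cf.
have cvg1 : (\int[mu]_(x in `]0%R, +oo[) (f \_ (I n) x)%:E @[n --> \oo] -->
    \int[mu]_(x in `]0%R, +oo[) (f x)%:E)%E.
  apply: (@dominated_cvg _ _ _ mu `]0, +oo[ _ (fun n x => (f \_ (I n) x)%:E)
    (EFin \o f) (fun x => `|(f x)%:E|%E)) => //=.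
  - move=> n; apply/measurable_EFinP.
    apply/measurable_restrict; [exact: measurable_itv|exact: measurable_itv|].
    apply: measurable_funS mf; [exact: measurable_itv|exact: subIsetl].
  - move=> x; rewrite in_itv/= andbT => x0.
    apply: cvg_near_cst; near=> n.
    rewrite patchE mem_set// /I/= in_itv/=; apply/andP; split.
      rewrite -[leRHS]invrK lef_pV2 ?posrE ?invr_gt0//.
      rewrite (@le_trans _ _ n%:R) ?ler_nat//.
      by near: n; exact: nbhs_infty_ger.
    rewrite (@le_trans _ _ n%:R) ?ler_nat//.
    + by near: n; exact: nbhs_infty_ger.
    + by rewrite ltnW.
  - exact: (integrable_abse intf).
  - move=> n x _; rewrite lee_fin patchE; case: ifPn => // _.
    by rewrite normr0.
have cvg2 : (\int[mu]_(x in `]0%R, +oo[) (f \_ (I n) x)%:E @[n --> \oo] -->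
    (l - l0)%:E)%E.
  have dF' x : 0 < x -> derivable F x 1 by move=> /dF [].
  have cF x : 0 < x -> {for x, continuous F}.
    by move=> x0; apply/differentiable_continuous/derivable1_diffP/dF'.
  rewrite [X in X @ _ --> _](_ : _ = fun n => (F n.+2%:R - F (n.+1%:R)^-1)%:E).
    apply: cvg_EFin; first exact: nearW.
    apply: cvgB; last exact: cvg_invn_right0.
    have Fn := (cvg_pinftyP F l).1 Fy (fun n => n.+2%:R).
    apply: Fn; apply/cvgryPge => r.
    near=> n; rewrite (@le_trans _ _ n%:R) ?ler_nat//.
    + by near: n; exact: nbhs_infty_ger.
    + by rewrite ltnW.
  apply/funext => n; rewrite EFinB.
  rewrite -(@continuous_FTC2 _ f) //.
  - rewrite [RHS]integral_mkcond [LHS]integral_mkcond/=.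
    apply: eq_integral => x _; rewrite !patchE.
    rewrite -/(I n); case: (boolP (x \in I n)) => [|] xI.
      by rewrite ifT// inE/= in_itv/= andbT (Ipos n)//; rewrite inE in xI.
    by case: ifP.
  - by rewrite (@le_lt_trans _ _ 1) ?invf_le1 ?ler1n ?ltr1n.
  - apply: continuous_in_subspaceT => x; rewrite inE => /Ipos; exact: cf.
  - split.
    + move=> x; rewrite in_itv/= => /andP[nx _]; apply: dF'.
      by rewrite (lt_trans _ nx).
    + by apply: cvg_at_right_filter; exact: cF.
    + by apply: cvg_at_left_filter; exact: cF.
  - move=> x; rewrite in_itv/= => /andP[nx _]; rewrite derive1E.
    by have [_ ->] := dF _ (lt_trans (vpos n) nx).
exact: cvg_unique cvg1 cvg2.
Unshelve. all: by end_near. Qed.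




(** [c] times the pushforward of Lebesgue measure under [x -> c x] gives each half-open interval its
    length, and this characterizes Lebesgue measure. *)
Lemma lebesgue_measure_scale (c : R) (A : set (measurableTypeR R)) :
  0 < c -> measurable A -> (c%:E * mu ( *%R c @^-1` A))%E = mu A.
Proof.
move=> c0 mA.
have mc : measurable_fun [set: measurableTypeR R]
    ( *%R c : _ -> measurableTypeR R) by exact: mulrl_measurable.
pose m : {measure set (measurableTypeR R) -> \bar R} :=
  mscale (NngNum (ltW c0))
    (measure_function_pushforward__canonical__measure_function_Measure mu mc).
apply/esym/(@lebesgue_measure_unique _ m) => //= _ [[a b]] _ <-.
rewrite /m/= /mscale/= /pushforward.
rewrite (_ : *%R c @^-1` _ = `]a / c, b / c]%classic); last first.
  by apply/seteqP; split => x;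
    rewrite /= !in_itv/= ltr_pdivrMr// ler_pdivlMr// mulrC.
rewrite !lebesgue_measure_itv/= !lte_fin ltr_pM2r ?invr_gt0//.
case: ifP => _; last by rewrite mule0.
by rewrite -!EFinB -EFinM -mulrBl mulrCA divff ?mulr1 ?gt_eqF.
Qed.

Lemma ge0_integral_scale (c : R) (f : R -> \bar R) : 0 < c ->
  measurable_fun [set: measurableTypeR R] f -> (forall x, 0 <= f x)%E ->
  (\int[mu]_x f x = c%:E * \int[mu]_x f (c * x)%R)%E.
Proof.
move=> c0 mf f0.
have mc : measurable_fun [set: measurableTypeR R]
    ( *%R c : _ -> measurableTypeR R) by exact: mulrl_measurable.
pose phi : {measure set (measurableTypeR R) -> \bar R} :=
  measure_function_pushforward__canonical__measure_function_Measure mu mc.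
rewrite -(@eq_measure_integral _ _ _ setT mu (mscale (NngNum (ltW c0)) phi)).
  rewrite ge0_integral_mscale//=; congr (_ * _)%E.
  by rewrite ge0_integral_pushforward.
by move=> A mA _; exact: lebesgue_measure_scale.
Qed.

Lemma integral_scale (c : R) (f : R -> \bar R) : 0 < c ->
  measurable_fun [set: measurableTypeR R] f ->
  mu.-integrable setT (fun x => f (c * x)) ->
  (\int[mu]_x f x = c%:E * \int[mu]_x f (c * x)%R)%E.
Proof.
move=> c0 mf intf.
rewrite [LHS]integralE [X in (_ * X)%E]integralE.
rewrite (ge0_integral_scale c0 (measurable_funepos mf))//.
rewrite (ge0_integral_scale c0 (measurable_funeneg mf))//.
rewrite (muleBr _ (integrable_add_def measurableT intf))//.
by congr (_ * _ - _ * _)%E; apply: eq_integral => x _; rewrite !unlock.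
Qed.

End improper_integrals.

(** * The gamma function *)

Section gamma_function.
Context {R : realType}.
Local Notation mu := (@lebesgue_measure R).
Implicit Types p alpha b : R.

Lemma continuous_powR_expR p b (x : R) : 0 < x ->
  {for x, continuous (fun x => x `^ p * expR (- (b * x)))}.
Proof.
move=> x0; apply/differentiable_continuous/derivable1_diffP.
apply: derivableM => //.
by apply: derivable_powR; rewrite in_itv/= andbT.
Qed.

(* The derivative [p x^(p-1) (1 + x)^(-p-1)] is an integrable majorant, up to a
   constant, of [x^(p-1) e^(-b x)]. *)
Lemma is_derive_odds p (x : R) : 0 < x ->
  is_derive x 1 (fun x : R => (1 - (1 + x)^-1) `^ p)
    (p * (1 - (1 + x)^-1) `^ (p - 1) * (1 + x) ^- 2).
Proof.
move=> x0.
have x10 : 1 + x != 0 by rewrite gt_eqF// addr_gt0.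
have h0 : 0 < 1 - (1 + x)^-1 by rewrite subr_gt0 invf_lt1 ?ltrDl// addr_gt0.
have d1 : is_derive x 1 (fun x : R => 1 - (1 + x)^-1) ((1 + x) ^- 2).
  have d2 := @is_deriveV R (fun x => 1 + x) x (0 + 1) 1 x10 _.
  apply: is_derive_eq.
  by rewrite /GRing.scale/= !add0r !mul1r mulr1 opprK.
have := @is_derive1_comp R (fun y => y `^ p) (fun x => 1 - (1 + x)^-1) x _ _
  (is_derive1_powR p h0) d1.
by [].
Qed.

Lemma powR_expR_le p b : 0 < p -> 0 < b ->
  exists2 C : R, 0 < C & forall x : R, 0 < x ->
    expR (- (b * x)) <= C * (1 + x) `^ (- p).
Proof.
(* With [c = b / p], the [p]-th power of [e^(c x)] is [e^(b x)]; with [K = 1 + 1/c], the product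
   [K (1 + c x)] exceeds [1 + x]. *)
move=> p0 b0; pose c := b / p; have c0 : 0 < c by rewrite divr_gt0.
pose K := 1 + c^-1; have K0 : 0 < K by rewrite addr_gt0 ?invr_gt0.
exists (K `^ p); first exact: powR_gt0.
move=> x x0; have x10 : 0 < 1 + x by rewrite addr_gt0.
have le1 : 1 + x <= K * expR (c * x).
  apply: (@le_trans _ _ (K * (1 + c * x))).
    have -> : K * (1 + c * x) = 1 + c * x + c^-1 + x.
      by rewrite /K; field; rewrite gt_eqF.
    have : 0 < c * x by rewrite mulr_gt0.
    have : 0 < c^-1 by rewrite invr_gt0.
    lra.
  by rewrite ler_pM2l// expR_ge1Dx.
have le2 : (1 + x) `^ p <= K `^ p * expR (b * x).
  have -> : expR (b * x) = expR (c * x) `^ p.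
    by rewrite -expRM /c; congr (expR _); rewrite mulrAC divfK ?gt_eqF.
  rewrite -powRM ?expR_ge0 ?(ltW K0)//.
  apply: ge0_ler_powR; rewrite ?nnegrE ?(ltW p0) ?(ltW x10)//.
  by rewrite mulr_ge0 ?expR_ge0 ?ltW.
by rewrite powRN expRN ler_pdivlMr ?powR_gt0// ler_pdivrMl ?expR_gt0// mulrC.
Qed.

Lemma integrable_powR_expR p b : 0 < p -> 0 < b ->
  mu.-integrable `](0 : R), +oo[
    (EFin \o (fun x => x `^ (p - 1) * expR (- (b * x)))).
Proof.
move=> p0 b0.
pose h (x : R) := p * (1 - (1 + x)^-1) `^ (p - 1) * (1 + x) ^- 2.
have h0 x : 0 < x -> 0 <= h x.
  move=> x0; rewrite mulr_ge0 ?invr_ge0 ?exprn_ge0 ?addr_ge0 ?(ltW x0)//.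
  by rewrite mulr_ge0 ?powR_ge0// ltW.
have hE x : 0 < x -> h x = p * x `^ (p - 1) * (1 + x) `^ (- (p + 1)).
  move=> x0; have x10 : 0 < 1 + x by rewrite addr_gt0.
  rewrite /h -!mulrA; congr (_ * _).
  have -> : 1 - (1 + x)^-1 = x * (1 + x)^-1 by field; rewrite gt_eqF.
  rewrite powRM ?invr_ge0 ?(ltW x0) ?(ltW x10)// -mulrA; congr (_ * _).
  have -> : (1 + x)^-1 `^ (p - 1) = (1 + x) `^ (- (p - 1)).
    by rewrite -(powR_inv1 (ltW x10)) -powRrM mulN1r.
  rewrite -powR_mulrn ?(ltW x10)// -powRN.
  rewrite -powRD; last by rewrite (gt_eqF x10) implybT.
  by congr (_ `^ _); ring.
have ch x : 0 < x -> {for x, continuous h}.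
  move=> x0; have x10 : 1 + x != 0 by rewrite gt_eqF// addr_gt0.
  apply/differentiable_continuous/derivable1_diffP.
  apply: derivableM.
    apply: derivableM => //.
    by have [] := is_derive_odds (p - 1) x0.
  by apply: derivableV; rewrite ?expf_neq0//.
(* The primitive [(x / (1 + x))^p] increases from 0 to 1. *)
have inth : (\int[mu]_(x in `]0%R, +oo[) (h x)%:E = (1 - 0)%:E)%E.
  apply: (@ge0_FTC_oy _ h (fun x : R => (1 - (1 + x)^-1) `^ p)) => //.
  - by move=> x; exact: is_derive_odds.
  - apply: (@squeeze_cvgr _ _ _ _ (cst 0) (fun x => x `^ p)); last 2 first.
      exact: cvg_cst.
      exact: powR_cvg0.
    near=> x; have x0 : 0 < x by [].
    rewrite powR_ge0/=.
    apply: ge0_ler_powR; rewrite ?nnegrE ?(ltW p0) ?(ltW x0)//.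
      by rewrite subr_ge0 invf_le1 ?lerDl ?(ltW x0)// addr_gt0.
    rewrite (_ : 1 - (1 + x)^-1 = x * (1 + x)^-1); last first.
      by field; rewrite gt_eqF// addr_gt0.
    by rewrite ler_piMr ?(ltW x0)// invf_le1 ?lerDl ?(ltW x0)// addr_gt0.
  - have cp : {for (1 : R), continuous (fun x => x `^ p)}.
      apply/differentiable_continuous/derivable1_diffP/derivable_powR.
      by rewrite in_itv/= andbT.
    suff : (1 - (1 + x)^-1) `^ p @[x --> +oo] --> (1 : R) `^ p by rewrite powR1.
    apply: (continuous_cvg _ cp).
    rewrite -[X in _ --> X]subr0; apply: cvgB; first exact: cvg_cst.
    apply/(@gtr0_cvgV0 _ _ _ _ (fun x => 1 + x)).
      by near=> x; rewrite addr_gt0.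
    apply/cvgryPge => A; near=> x; rewrite (@le_trans _ _ x)// ?lerDr//.
(* The exponent [p + 1] is the decay of [h] in [hE], so that [(C / p) h] dominates the integrand. *)
have [C C0 hC] := powR_expR_le (addr_gt0 p0 ltr01) b0.
have mg : measurable_fun `](0 : R), +oo[
    (fun x => x `^ (p - 1) * expR (- (b * x))).
  by apply: measurable_fun_continuous_oy => x; exact: continuous_powR_expR.
have mh := measurable_fun_continuous_oy ch.
apply/integrableP; split; first exact/measurable_EFinP.
apply: (@le_lt_trans _ _ (\int[mu]_(x in `]0%R, +oo[) ((C / p)%:E * (h x)%:E))%E).
  apply: ge0_le_integral => //=.
  - by apply/measurable_EFinP/measurableT_comp.
  - by apply: measurable_funeM; apply/measurable_EFinP.
  - move=> x; rewrite in_itv/= andbT => x0.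
    rewrite ger0_norm ?mulr_ge0 ?powR_ge0 ?expR_ge0// -EFinM lee_fin hE//.
    rewrite -!mulrA mulKf ?gt_eqF// mulrCA ler_pM2l ?powR_gt0//.
    exact: hC.
rewrite ge0_integralZl//.
- by rewrite inth -EFinM ltry.
- exact/measurable_EFinP.
- by move=> x/=; rewrite in_itv/= andbT => /h0; rewrite lee_fin.
- by rewrite lee_fin divr_ge0// ltW.
Unshelve. all: by end_near. Qed.

Lemma GammaE alpha : 0 < alpha ->
  (\int[mu]_(x in `]0%R, +oo[) (x `^ (alpha - 1) * expR (- x))%:E
   = (Gamma alpha)%:E)%E.
Proof.
move=> a0; rewrite /Gamma /Rintegral fineK//.
apply: integrable_fin_num => //.
have := integrable_powR_expR a0 ltr01.
by apply: eq_integrable => // x _ /=; rewrite mul1r.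
Qed.

(** A zero integral would force the nonnegative integrand to vanish almost everywhere, yet it is
    positive on []0, 1[], which has measure 1. *)
Lemma Gamma_gt0 alpha : 0 < alpha -> 0 < Gamma alpha.
Proof.
move=> a0; rewrite lt_neqAle Gamma_ge0 andbT; apply/negP => /eqP G0.
have := GammaE a0; rewrite -G0.
pose f x := x `^ (alpha - 1) * expR (- x) : R.
have mf : measurable_fun `](0 : R), +oo[ (EFin \o f).
  have := integrable_powR_expR a0 ltr01 => /integrableP[+ _].
  by apply: eq_measurable_fun => x _ /=; rewrite mul1r.
rewrite (eq_integral (fun x : measurableTypeR R => `|(f x)%:E|%E)); last first.
  by move=> x _ /=; rewrite ger0_norm// mulr_ge0 ?powR_ge0 ?expR_ge0.
move=> H; have [N [mN N0 sN]] := (ae_eq_integral_abs mu (measurable_itv _) mf).1 H.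
have : `](0 : R), 1[%classic `<=` N.
  move=> x; rewrite /= in_itv/= => /andP[x0 _]; apply: sN => /=.
  rewrite in_itv/= x0 => /(_ isT) [] /eqP; apply/negP.
  by rewrite gt_eqF// mulr_gt0 ?powR_gt0 ?expR_gt0.
move=> /(le_measure mu); rewrite !inE => /(_ (measurable_itv _) mN).
rewrite [X in (_ <= X)%E](_ : _ = 0%E) ?[LHS]N0//= lebesgue_measure_itv/=.
by rewrite lte_fin ltr01 oppr0 adde0 lee_fin ler10.
Qed.

Lemma Gamma1 : Gamma 1 = 1 :> R.
Proof.
have := GammaE (@ltr01 R) => H; apply: EFin_inj; rewrite -H.
under eq_integral do rewrite subrr powRr0 mul1r.
have dF (x : R) : 0 < x -> is_derive x 1 (fun x => - expR (- x)) (expR (- x)).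
  by move=> _; apply: is_derive_eq; rewrite mulrN1 opprK.
rewrite (@ge0_FTC_oy _ _ (fun x => - expR (- x)) (- 1) 0 _ _ dF).
- by rewrite sub0r opprK.
- by move=> x _; exact: expR_ge0.
- move=> x _; apply/differentiable_continuous/derivable1_diffP.
  exact: ex_derive.
- apply: cvg_at_right_filter.
  rewrite -[X in _ --> - X]expR0 -[X in expR X]oppr0.
  by apply: cvgN; apply: continuous_cvg;
    [exact: continuous_expR|exact: continuousN].
- by rewrite -[X in _ --> X]oppr0; apply: cvgN; exact: cvgr_expR.
Qed.

Lemma cvg_powR_expR_y p b : 0 <= p -> 0 < b ->
  x `^ p * expR (- (b * x)) @[x --> +oo] --> (0 : R).
Proof.
move=> p0 b0.
have p10 : 0 < p + 1 by rewrite ltr_wpDl.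
(* One power more than [p] leaves the vanishing bound [C / (1 + x)]. *)
have [C C0 hC] := powR_expR_le p10 b0.
apply: (@squeeze_cvgr _ _ _ _ (cst 0) (fun x => C * (1 + x)^-1)).
- near=> x; have x0 : 0 < x by [].
  have x10 : 0 < 1 + x by rewrite addr_gt0.
  rewrite mulr_ge0 ?powR_ge0 ?expR_ge0//=.
  rewrite (le_trans (ler_wpM2l (powR_ge0 _ _) (hC _ x0)))// mulrCA ler_pM2l//.
  rewrite powRN powRD ?(gt_eqF x10) ?implybT// powRr1 ?(ltW x10)//.
  rewrite invfM mulrA ler_piMl ?invr_ge0 ?(ltW x10)//.
  rewrite ler_pdivrMr ?powR_gt0// mul1r.
  by apply: ge0_ler_powR; rewrite ?nnegrE ?(ltW x0) ?(ltW x10)// lerDr.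
- exact: cvg_cst.
- rewrite -(mulr0 C); apply: cvgM; first exact: cvg_cst.
  apply/(@gtr0_cvgV0 _ _ _ _ (fun x => 1 + x)).
    by near=> x; rewrite addr_gt0.
  by apply/cvgryPge => A; near=> x; rewrite (@le_trans _ _ x)// ?lerDr//.
Unshelve. all: by end_near. Qed.

Lemma integrable_powR_expRM p b (T : R -> R) (M : R) : 0 < p -> 0 < b ->
  measurable_fun setT T -> (forall x, `|T x| <= M) ->
  mu.-integrable `](0 : R), +oo[
    (EFin \o (fun x => x `^ (p - 1) * expR (- (b * x)) * T x)).
Proof.
move=> p0 b0 mT TM.
apply: (@integrableMl _ (measurableTypeR R) R mu _ (measurable_itv _) _ T
  (integrable_powR_expR p0 b0)); first exact: measurable_funTS.
exists M; split; [exact: num_real|move=> y My]; move=> x _ /=.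
by rewrite (le_trans (TM x))// ltW.
Qed.

(* The boundary term at [0] survives only for [alpha = 0]; the first integral
   may then diverge, but it is multiplied by [0]. *)
Lemma gamma_ibp alpha b (T T' : R -> R) (M : R) :
  0 <= alpha -> 0 < b ->
  (forall x : R, is_derive x 1 T (T' x)) -> continuous T' ->
  (forall x, `|T x| <= M) -> (forall x, `|T' x| <= M) ->
  alpha * \int[mu]_(x in `]0%R, +oo[) (x `^ (alpha - 1) * expR (- (b * x)) * T x)
  - b * \int[mu]_(x in `]0%R, +oo[) (x `^ alpha * expR (- (b * x)) * T x)
  + \int[mu]_(x in `]0%R, +oo[) (x `^ alpha * expR (- (b * x)) * T' x)
  = - (alpha == 0)%:R * T 0.
Proof.
move=> a0 b0 dT cT' TM T'M.
have dT1 x : derivable T x 1 by have [] := dT x.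
have cT : continuous T.
  by move=> x; apply/differentiable_continuous/derivable1_diffP.
have mT : measurable_fun setT T by exact: continuous_measurable_fun.
have mT' : measurable_fun setT T' by exact: continuous_measurable_fun.
pose k p x := x `^ p * expR (- (b * x)) : R.
have a10 : 0 < alpha + 1 by rewrite ltr_wpDl.
have ia1 (T1 : R -> R) : measurable_fun setT T1 -> (forall x, `|T1 x| <= M) ->
    mu.-integrable `](0 : R), +oo[ (EFin \o (fun x => k alpha x * T1 x)).
  move=> mT1 T1M; have := integrable_powR_expRM a10 b0 mT1 T1M.
  by rewrite addrK.
have ia : mu.-integrable `](0 : R), +oo[
    (EFin \o (fun x => alpha * (k (alpha - 1) x * T x))).
  have [->|a_neq0] := eqVneq alpha 0.
    apply: eq_integrable (integrable0 _ _) => //= x _.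
    by rewrite mul0r.
  apply: (@integrableZl _ (measurableTypeR R) R mu _ (measurable_itv _) alpha
    (fun x => (k (alpha - 1) x * T x)%:E)).
  apply: (integrable_powR_expRM (M := M)) => //.
  by rewrite lt_neqAle eq_sym a_neq0.
have ib : mu.-integrable `](0 : R), +oo[
    (EFin \o (fun x => b * (k alpha x * T x))).
  by apply: (@integrableZl _ (measurableTypeR R) R mu _ (measurable_itv _) b
    (fun x => (k alpha x * T x)%:E)); exact: ia1.
have -> : alpha * \int[mu]_(x in `]0%R, +oo[) (k (alpha - 1) x * T x) =
    \int[mu]_(x in `]0%R, +oo[) (alpha * (k (alpha - 1) x * T x)).
  have [->|a_neq0] := eqVneq alpha 0.
    rewrite mul0r; under [RHS]eq_Rintegral do rewrite mul0r.
    by rewrite Rintegral_cst// mul0r.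
  rewrite RintegralZl//.
  apply: (integrable_powR_expRM (M := M)) => //.
  by rewrite lt_neqAle eq_sym a_neq0.
rewrite -RintegralZl//; last exact: ia1.
rewrite -RintegralB// -RintegralD//; last 2 first.
- exact: (integrableB _ ia ib).
- exact: ia1.
have dF (x : R) : 0 < x -> is_derive x 1 (fun x => k alpha x * T x)
    (alpha * (k (alpha - 1) x * T x) - b * (k alpha x * T x) + k alpha x * T' x).
  move=> x0; have d1 := @is_derive1_powR R alpha x x0.
  apply: is_derive_eq.
  rewrite /GRing.scale/= /k; ring.
rewrite /Rintegral (@integrable_FTC_oy _ _ _ ((alpha == 0)%:R * T 0) 0 _ _ dF).
- by rewrite sub0r mulNr.
- exact: (integrableD _ (integrableB _ ia ib) (ia1 _ _ _)).
- move=> x x0.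
  have ck p : {for x, continuous (k p)} by exact: continuous_powR_expR.
  apply: (@cvgD _ R^o); first apply: (@cvgB _ R^o).
  + apply: cvgM; first exact: cvg_cst.
    by apply: cvgM; [exact: ck|exact: cT].
  + apply: cvgM; first exact: cvg_cst.
    by apply: cvgM; [exact: ck|exact: cT].
  + by apply: cvgM; [exact: ck|exact: cT'].
- apply: cvgM; last by apply: cvg_at_right_filter; exact: cT.
  have cexp : expR (- (b * x)) @[x --> (0 : R)^'+] --> (1 : R).
    rewrite -[X in _ --> X]expR0 -[X in expR X]oppr0 -[X in - X](mulr0 b).
    apply: cvg_at_right_filter.
    have : {for (0 : R), continuous (fun x => expR (- (b * x)))}.
      by apply/differentiable_continuous/derivable1_diffP; exact: ex_derive.
    exact.
  have [->|a_neq0] := eqVneq alpha 0.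
    rewrite /k; under eq_fun do rewrite powRr0 mul1r.
    exact: cexp.
  rewrite [X in _ --> X](_ : _ = 0 * 1); last by rewrite mul0r.
  rewrite /k; apply: cvgM => //.
  by apply: powR_cvg0; rewrite lt_neqAle eq_sym a_neq0.
- have := cvg_powR_expR_y a0 b0; rewrite -/(k alpha _) => k0.
  apply: (@squeeze_cvgr _ _ _ _
    (fun x => k alpha x * (- M)) (fun x => k alpha x * M)).
  + near=> x.
    have k_ge0 : 0 <= k alpha x by rewrite mulr_ge0 ?powR_ge0 ?expR_ge0.
    have := TM x; rewrite ler_norml => /andP[T1 T2].
    by rewrite !ler_wpM2l.
  + by rewrite -(mul0r (- M)); apply: cvgM => //; exact: cvg_cst.
  + by rewrite -(mul0r M); apply: cvgM => //; exact: cvg_cst.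
Unshelve. all: by end_near. Qed.

(** Integration by parts with rate 1 and constant test function 1, whose derivative term
    vanishes. *)
Lemma GammaS alpha : 0 < alpha -> Gamma (alpha + 1) = alpha * Gamma alpha.
Proof.
move=> a0.
have c0 : continuous (cst 0 : R -> R) by move=> x; exact: cvg_cst.
have := @gamma_ibp alpha 1 (cst 1) (cst 0) 1 (ltW a0) ltr01
  (fun=> is_derive_cst _ _ _) c0.
rewrite /cst; have H1 : R -> `|1 : R| <= 1 by move=> _; rewrite normr1.
have H0 : R -> `|0 : R| <= 1 by move=> _; rewrite normr0.
move=> /(_ H1 H0); rewrite gt_eqF// mulNr mul0r oppr0 mul1r.
under [X in alpha * X]eq_Rintegral do rewrite mul1r mulr1.
under [X in _ - X]eq_Rintegral do rewrite mul1r mulr1.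
under [X in _ + X]eq_Rintegral do rewrite mulr0.
rewrite Rintegral_cst// mul0r addr0 => /eqP; rewrite subr_eq0 => /eqP.
by rewrite /Gamma addrK.
Qed.

Lemma Gamma_prod alpha n : 0 < alpha ->
  Gamma (alpha + n%:R) = (\prod_(i < n) (alpha + i%:R)) * Gamma alpha.
Proof.
move=> a0; elim: n => [|n IHn]; first by rewrite big_ord0 addr0 mul1r.
rewrite -natr1 addrA GammaS; last by rewrite ltr_wpDr.
rewrite IHn big_ord_recr/=.
by rewrite mulrCA mulrA.
Qed.

End gamma_function.

(** * Integration against a measure given by a density *)

Section density.
Context {R : realType}.
Local Notation mu := (@lebesgue_measure R).
Variables (m : {measure set (measurableTypeR R) -> \bar R}) (f : R -> R).
Hypothesis mf : measurable_fun [set: measurableTypeR R] f.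
Hypothesis f0 : forall x, 0 <= f x.
Hypothesis mE : forall A, measurable A -> m A = (\int[mu]_(x in A) (f x)%:E)%E.

Import HBNNSimple.

Local Lemma integral_density_nnsfun (h : {nnsfun measurableTypeR R >-> R}) :
  (\int[m]_x (h x)%:E = \int[mu]_x ((h x)%:E * (f x)%:E))%E.
Proof.
under [LHS]eq_integral do rewrite fimfunE -fsumEFin//.
rewrite [LHS]ge0_integral_fsum//; last 2 first.
  - by move=> r; exact/measurable_EFinP/measurableT_comp.
  - by move=> n x _; rewrite EFinM nnfun_muleindic_ge0.
under [RHS]eq_integral.
  move=> x xD; rewrite fimfunE -fsumEFin// ge0_mule_fsuml; last first.
    by move=> r; rewrite EFinM nnfun_muleindic_ge0.
  over.
rewrite [RHS]ge0_integral_fsum//; last 2 first.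
  - move=> r; apply: emeasurable_funM; apply/measurable_EFinP => //.
    by apply/measurableT_comp.
  - move=> n x _; rewrite mule_ge0 ?lee_fin//.
    by rewrite -lee_fin EFinM nnfun_muleindic_ge0.
apply: eq_fsbigr => r _.
have [r0|r0] := ltP r 0.
  rewrite preimage_nnfun0//.
  under eq_integral do rewrite indic0 mulr0.
  under [RHS]eq_integral do rewrite indic0 mulr0 mul0e.
  by rewrite !integral0.
rewrite integralZl_indic_nnsfun// integral_indic// setIT mE//.
under [RHS]eq_integral do rewrite EFinM -muleA.
rewrite ge0_integralZl//; last 2 first.
- apply: emeasurable_funM; apply/measurable_EFinP => //.
- by move=> x _; rewrite mule_ge0 ?lee_fin.
congr (_ * _)%E; rewrite [LHS]integral_mkcond/=; apply: eq_integral => x _.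
by rewrite epatch_indic muleC.
Qed.

Lemma ge0_integral_density (h : R -> \bar R) :
  measurable_fun [set: measurableTypeR R] h -> (forall x, 0 <= h x)%E ->
  (\int[m]_x h x = \int[mu]_x (h x * (f x)%:E))%E.
Proof.
move=> mh h0; pose h_ := nnsfun_approx measurableT mh.
have cvgh x : (h_ n x)%:E @[n --> \oo] --> h x.
  by apply: cvg_nnsfun_approx.
have ndh x : {homo (fun n => (h_ n x)%:E) : i j / (i <= j)%N >-> (i <= j)%E}.
  by move=> i j ij; rewrite lee_fin; exact/lefP/nd_nnsfun_approx.
transitivity (limn (fun n => \int[m]_x (h_ n x)%:E))%E.
  rewrite -monotone_convergence//=.
  - by apply: eq_integral => x _; apply/esym/cvg_lim => //; exact: cvgh.
  - by move=> n; exact/measurable_EFinP.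
  - by move=> n x _; rewrite lee_fin.
under eq_fun do rewrite integral_density_nnsfun.
rewrite -monotone_convergence//=.
- apply: eq_integral => x _; apply/cvg_lim => //.
  by apply: cvgeZr => //; exact: cvgh.
- by move=> n; apply: emeasurable_funM; exact/measurable_EFinP.
- by move=> n x _; rewrite mule_ge0 ?lee_fin.
- by move=> x _ i j ij; rewrite lee_wpmul2r ?lee_fin// -lee_fin ndh.
Qed.

Lemma integral_density (h : R -> R) :
  measurable_fun [set: measurableTypeR R] h ->
  (\int[m]_x (h x)%:E = \int[mu]_x (h x * f x)%:E)%E.
Proof.
move=> /measurable_EFinP mh.
rewrite [LHS]integralE [RHS]integralE.
rewrite (ge0_integral_density (measurable_funepos mh))//.
rewrite (ge0_integral_density (measurable_funeneg mh))//.
congr (_ - _)%E; apply: eq_integral => x _; rewrite !unlock/=.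
  by rewrite -!EFin_max -EFinM maxr_pMl// mul0r.
by rewrite -!EFin_max -EFinM maxr_pMl// mul0r mulNr.
Qed.
End density.

(* [R] and [measurableTypeR R] carry the same sigma-algebra under different
   displays, hence have distinct types of measures. *)
Section display_change.
Context {R : realType} (m : {measure set R -> \bar R}).

Let measurable_toR :
  measurable_fun [set: R] (fun x : R => x : measurableTypeR R).
Proof. exact: measurable_id. Qed.

Definition measure_toR : {measure set (measurableTypeR R) -> \bar R} :=
  measure_function_pushforward__canonical__measure_function_Measure m
    measurable_toR.

Lemma measure_toRE (A : set R) : measure_toR A = m A.
Proof. by []. Qed.

Lemma ge0_integral_toR (h : R -> \bar R) : measurable_fun [set: R] h ->
  (forall x, 0 <= h x)%E -> (\int[measure_toR]_x h x = \int[m]_x h x)%E.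
Proof. by move=> mh h0; rewrite /measure_toR ge0_integral_pushforward. Qed.

Lemma integral_toR (h : R -> \bar R) : measurable_fun [set: R] h ->
  (\int[measure_toR]_x h x = \int[m]_x h x)%E.
Proof.
move=> mh; rewrite [LHS]integralE [RHS]integralE.
by rewrite !ge0_integral_toR//;
  [exact: measurable_funeneg|exact: measurable_funepos].
Qed.

End display_change.

(** * The gamma laws and their characteristic functions *)

Section gamma_law_theory.
Context {R : realType}.
Local Notation mu := (@lebesgue_measure R).
Implicit Types alpha beta b : R.

Lemma gamma_pdf_oy alpha b x : 0 < alpha -> 0 < b -> 0 < x ->
  gamma_pdf alpha b x =
  b `^ alpha / Gamma alpha * (x `^ (alpha - 1) * expR (- (b * x))).
Proof.
move=> a0 b0 x0; rewrite /gamma_pdf a0 b0 x0/= powRM ?ltW//.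
have -> : b `^ alpha = b * b `^ (alpha - 1).
  rewrite -[in LHS](subrK 1 alpha) (@powRD _ b (alpha - 1) 1); last first.
    by rewrite (gt_eqF b0) implybT.
  by rewrite powRr1 ?(ltW b0)// mulrC.
by rewrite -!mulrA; congr (_ * _); rewrite mulrCA.
Qed.

Lemma gamma_pdf_Ny0 alpha b x : x <= 0 -> gamma_pdf alpha b x = 0.
Proof. by move=> x0; rewrite /gamma_pdf [0 < x]ltNge x0/= !andbF. Qed.

(** Density form of the fact that multiplying a variable of law [gamma_law alpha b] by [c] divides
    the rate by [c]. *)
Lemma gamma_pdf_scale alpha b (c x : R) : 0 < c ->
  gamma_pdf alpha (b / c) (c * x) = c^-1 * gamma_pdf alpha b x.
Proof.
move=> c0; rewrite /gamma_pdf (pmulr_rgt0 x c0) pmulr_lgt0 ?invr_gt0//.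
case: ifP => _; last by rewrite mulr0.
rewrite [b / c * (c * x)]mulrA (divfK _ b) ?gt_eqF//.
by rewrite [b / c]mulrC -!mulrA.
Qed.

Lemma measurable_EFin_gamma_pdf alpha b :
  measurable_fun [set: measurableTypeR R] (EFin \o gamma_pdf alpha b).
Proof. by apply/measurable_EFinP; exact: measurable_gamma_pdf. Qed.

Lemma integral_gamma_pdf alpha b : 0 < alpha -> 0 < b ->
  (\int[mu]_x (gamma_pdf alpha b x)%:E = 1)%E.
Proof.
move=> a0 b0.
(* Rescaling by [1 / b] reduces to rate 1, where the integral is the one defining [Gamma]. *)
transitivity (\int[mu]_x (gamma_pdf alpha 1 x)%:E)%E.
  have c0 : 0 < b^-1 by rewrite invr_gt0.
  rewrite (ge0_integral_scale c0 (measurable_EFin_gamma_pdf _ _)); last first.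
    by move=> x; rewrite lee_fin gamma_pdf_ge0.
  rewrite -ge0_integralZl ?lee_fin ?(ltW c0)//; last 2 first.
  - apply: measurableT_comp; first exact: measurable_EFin_gamma_pdf.
    exact: mulrl_measurable.
  - by move=> x _; rewrite lee_fin gamma_pdf_ge0.
  apply: eq_integral => x _; rewrite -EFinM.
  have := gamma_pdf_scale alpha 1 x c0; rewrite invrK mul1r => ->.
  by rewrite mulKf ?gt_eqF.
have -> : (fun x => (gamma_pdf alpha 1 x)%:E) =
    (fun x : measurableTypeR R => ((Gamma alpha)^-1%:E *
      (x `^ (alpha - 1) * expR (- x))%:E)%E) \_ `]0%R, +oo[.
  apply/funext => x; rewrite patchE mem_setE in_itv/= andbT.
  case: ltP => x0; last by rewrite gamma_pdf_Ny0.
  by rewrite gamma_pdf_oy// powR1 div1r mul1r.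
rewrite -integral_mkcond ge0_integralZl//.
- by rewrite GammaE// -EFinM mulVf// gt_eqF ?Gamma_gt0.
- have /integrableP[+ _] := integrable_powR_expR a0 ltr01.
  by apply: eq_measurable_fun => x _ /=; rewrite mul1r.
- by move=> x _; rewrite lee_fin mulr_ge0 ?powR_ge0 ?expR_ge0.
- by rewrite lee_fin invr_ge0 Gamma_ge0.
Qed.

Lemma gamma_law_setT alpha b : 0 < alpha -> 0 < b ->
  gamma_law alpha b setT = 1%E.
Proof. exact: integral_gamma_pdf. Qed.

Lemma integral_gamma_law alpha b (h : R -> R) : measurable_fun setT h ->
  (\int[gamma_law alpha b]_x (h x)%:E =
   \int[mu]_x (h x * gamma_pdf alpha b x)%:E)%E.
Proof.
move=> mh.
rewrite -integral_toR; last exact/measurable_EFinP.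
exact: (@integral_density _ (measure_toR (gamma_law alpha b)) _
  (measurable_gamma_pdf alpha b) (gamma_pdf_ge0 alpha b) (fun _ _ => erefl)).
Qed.

Lemma Rintegral_gamma_law alpha b (h : R -> R) (M : R) : 0 < alpha -> 0 < b ->
  measurable_fun setT h -> (forall x, `|h x| <= M) ->
  \int[gamma_law alpha b]_x h x = b `^ alpha / Gamma alpha *
  \int[mu]_(x in `]0, +oo[) (x `^ (alpha - 1) * expR (- (b * x)) * h x).
Proof.
move=> a0 b0 mh hM.
rewrite -RintegralZl//; last exact: integrable_powR_expRM hM.
rewrite {1}/Rintegral integral_gamma_law// [RHS]Rintegral_mkcond.
congr fine; apply: eq_integral => x _; congr EFin.
rewrite patchE mem_setE in_itv/= andbT.
case: ltP => x0; last by rewrite gamma_pdf_Ny0// mulr0.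
by rewrite gamma_pdf_oy// mulrC -!mulrA.
Qed.

(** This is [gamma_ibp] after normalization, the factor [alpha] being absorbed by
    [Gamma (alpha + 1)]. For [T] a cosine or a sine it gives the real and imaginary parts of the
    recursion for characteristic functions. *)
Lemma gamma_law_rec alpha b (T T' : R -> R) (M : R) : 0 < alpha -> 0 < b ->
  (forall x : R, is_derive x 1 T (T' x)) -> continuous T' ->
  (forall x, `|T x| <= M) -> (forall x, `|T' x| <= M) ->
  \int[gamma_law alpha b]_x T x =
  \int[gamma_law (alpha + 1) b]_x T x -
  b^-1 * \int[gamma_law (alpha + 1) b]_x T' x.
Proof.
move=> a0 b0 dT cT' TM T'M.
have cT : continuous T.
  move=> x; apply/differentiable_continuous/derivable1_diffP.
  by have [] := dT x.
have mT : measurable_fun setT T by exact: continuous_measurable_fun.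
have mT' : measurable_fun setT T' by exact: continuous_measurable_fun.
have a10 : 0 < alpha + 1 by rewrite ltr_wpDr.
apply: (eq_trans (Rintegral_gamma_law a0 b0 mT TM)); apply/esym.
apply: (eq_trans (f_equal2 (fun p q => p - b^-1 * q)
  (Rintegral_gamma_law a10 b0 mT TM) (Rintegral_gamma_law a10 b0 mT' T'M))).
rewrite addrK (GammaS a0); apply/esym.
have := gamma_ibp (ltW a0) b0 dT cT' TM T'M.
rewrite gt_eqF// oppr0 mul0r.
rewrite powRD ?gt_eqF ?implybT// powRr1 ?(ltW b0)//.
set X := Rintegral _ _ _; set Y := Rintegral _ _ _; set Z := Rintegral _ _ _.
move=> H.
have -> : X = (b * Y - Z) / alpha.
  by apply: (canRL (mulfK _)); rewrite ?gt_eqF// mulrC; lra.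
field; rewrite !gt_eqF ?Gamma_gt0//.
Qed.

(** The same recursion started at shape 0, where the gamma law degenerates to the point mass at 0:
    the boundary term [T 0] of the integration by parts takes the place of the integral. *)
Lemma gamma_law_rec1 b (T T' : R -> R) (M : R) : 0 < b ->
  (forall x : R, is_derive x 1 T (T' x)) -> continuous T' ->
  (forall x, `|T x| <= M) -> (forall x, `|T' x| <= M) ->
  T 0 = \int[gamma_law 1 b]_x T x - b^-1 * \int[gamma_law 1 b]_x T' x.
Proof.
move=> b0 dT cT' TM T'M.
have cT : continuous T.
  move=> x; apply/differentiable_continuous/derivable1_diffP.
  by have [] := dT x.
have mT : measurable_fun setT T by exact: continuous_measurable_fun.
have mT' : measurable_fun setT T' by exact: continuous_measurable_fun.
rewrite !(Rintegral_gamma_law (M := M))// subrr Gamma1 divr1 powRr1 ?(ltW b0)//.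
have := gamma_ibp (lexx 0) b0 dT cT' TM T'M.
rewrite eqxx mul0r sub0r mulN1r mulKf ?gt_eqF//.
by move=> H; lra.
Qed.

Lemma integrable_gamma_pdf alpha b : 0 < alpha -> 0 < b ->
  mu.-integrable setT (EFin \o gamma_pdf alpha b).
Proof.
move=> a0 b0; apply/integrableP; split; first exact: measurable_EFin_gamma_pdf.
under eq_integral do rewrite /= ger0_norm ?gamma_pdf_ge0//.
by rewrite integral_gamma_pdf// ltry.
Qed.

Lemma Rintegral_gamma_law_scale alpha b (c : R) (T : R -> R) (M : R) :
  0 < alpha -> 0 < b -> 0 < c ->
  measurable_fun setT T -> (forall x, `|T x| <= M) ->
  \int[gamma_law alpha (b / c)]_x T x = \int[gamma_law alpha b]_x T (c * x).
Proof.
move=> a0 b0 c0 mT TM.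
have mTc : measurable_fun setT (fun x => T (c * x)).
  by apply: measurableT_comp => //; exact: mulrl_measurable.
have mTp : measurable_fun [set: measurableTypeR R]
    (fun x => (T x * gamma_pdf alpha (b / c) x)%:E).
  apply/measurable_EFinP; apply: measurable_funM => //.
  exact: measurable_gamma_pdf.
have scE x : T (c * x) * gamma_pdf alpha (b / c) (c * x) =
    c^-1 * (T (c * x) * gamma_pdf alpha b x).
  by rewrite gamma_pdf_scale// mulrCA.
have iT : mu.-integrable setT
    (fun x => ((T (c * x)) * gamma_pdf alpha b x)%:E).
  apply: (@integrableMr _ (measurableTypeR R) R mu _ measurableT
    (fun x => T (c * x)) (EFin \o gamma_pdf alpha b)) => //.
    exists M; split; [exact: num_real|move=> y My x _ /=].
    by rewrite (le_trans (TM _))// ltW.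
  exact: integrable_gamma_pdf.
apply: (eq_trans (f_equal fine (integral_gamma_law alpha (b / c) mT))).
apply: (eq_trans _ (f_equal fine (esym (integral_gamma_law alpha b mTc)))).
congr fine.
rewrite (integral_scale c0 mTp).
  under eq_integral do rewrite scE EFinM.
  rewrite integralZl// muleA -EFinM divff ?gt_eqF// mul1e//.
apply: eq_integrable (integrableZl measurableT c^-1 iT) => // x _ /=.
by rewrite scE.
Qed.

Lemma is_derive_cosM (u x : R) :
  is_derive x 1 (fun x => cos (u * x)) (- u * sin (u * x)).
Proof.
apply: is_derive_eq.
by rewrite /GRing.scale/= mulr1 mulrC mulrN mulNr.
Qed.

Lemma is_derive_sinM (u x : R) :
  is_derive x 1 (fun x => sin (u * x)) (u * cos (u * x)).
Proof.
apply: is_derive_eq.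
by rewrite /GRing.scale/= mulr1 mulrC.
Qed.

Lemma continuous_cosM (u : R) : continuous (fun x => cos (u * x)).
Proof.
move=> x; apply/differentiable_continuous/derivable1_diffP.
by have [] := is_derive_cosM u x.
Qed.

Lemma continuous_sinM (u : R) : continuous (fun x => sin (u * x)).
Proof.
move=> x; apply/differentiable_continuous/derivable1_diffP.
by have [] := is_derive_sinM u x.
Qed.

Lemma measurable_cosM (u : R) : measurable_fun setT (fun x => cos (u * x)).
Proof. by apply: continuous_measurable_fun; exact: continuous_cosM. Qed.

Lemma measurable_sinM (u : R) : measurable_fun setT (fun x => sin (u * x)).
Proof. by apply: continuous_measurable_fun; exact: continuous_sinM. Qed.

Lemma cos_norm_le1 (x : R) : `|cos x| <= 1.
Proof. by rewrite ler_norml cos_geN1 cos_le1. Qed.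

Lemma sin_norm_le1 (x : R) : `|sin x| <= 1.
Proof. by rewrite ler_norml sin_geN1 sin_le1. Qed.

Lemma char_fun_gamma_scale alpha b (c u : R) : 0 < alpha -> 0 < b -> 0 < c ->
  char_fun (gamma_law alpha b) (c * u) = char_fun (gamma_law alpha (b / c)) u.
Proof.
move=> a0 b0 c0; rewrite /char_fun.
have Ec := Rintegral_gamma_law_scale a0 b0 c0 (measurable_cosM u)
  (fun x => cos_norm_le1 (u * x)).
have Es := Rintegral_gamma_law_scale a0 b0 c0 (measurable_sinM u)
  (fun x => sin_norm_le1 (u * x)).
apply: (eq_trans _ (esym (f_equal2 (@Complex R) Ec Es))).
apply: (f_equal2 (@Complex R)).
  by apply: eq_Rintegral => x _; rewrite mulrCA mulrA.
by apply: eq_Rintegral => x _; rewrite mulrCA mulrA.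
Qed.

(** The characteristic function of the exponential law of rate [b]. *)
Definition char_factor b (u : R) : R[i] := b%:C%C / (b%:C%C - 'i%C * u%:C%C).

Lemma char_factor_scale b (a u : R) : 0 < a ->
  char_factor b (a * u) = char_factor (b / a) u.
Proof.
move=> a0; rewrite /char_factor.
have a_neq0 : a%:C%C != 0 by rewrite eq_complex/= eqxx andbT gt_eqF.
rewrite !rmorphM/= fmorphV -[RHS]mulrA -invfM; congr (_ / _).
by rewrite mulrBr [_ * (_ / _)]mulrC divfK// mulrCA.
Qed.

(** The two real equations together say [c + i s = (1 - i u / b) (c' + i s')], and [1 - i u / b] is
    the inverse of the factor. They have the shape delivered by [gamma_law_rec]. *)
Lemma char_factorE b (u c s c' s' : R) : 0 < b ->
  c = c' - b^-1 * (- u * s') -> s = s' - b^-1 * (u * c') ->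
  (c' +i* s')%C = char_factor b u * (c +i* s)%C.
Proof.
move=> b0 -> ->; rewrite /char_factor.
have bu_neq0 : b%:C%C - 'i%C * u%:C%C != 0.
  rewrite eq_complex/= negb_and; apply/orP; left.
  by rewrite !mul0r mulr0 !subr0 gt_eqF.
apply: (mulfI bu_neq0); rewrite mulrA [_ * (_ / _)]mulrC divfK//.
by apply/eqP; rewrite eq_complex /=; apply/andP; split; apply/eqP; field;
  rewrite gt_eqF.
Qed.

(** Integration by parts takes a single bound for the test function and its derivative; [1 + |u|]
    serves for both. *)
Let cos_bound (u : R) (x : R) : `|cos (u * x)| <= 1 + `|u|.
Proof. by rewrite (le_trans (cos_norm_le1 _))// lerDl. Qed.

Let sin_bound (u : R) (x : R) : `|sin (u * x)| <= 1 + `|u|.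
Proof. by rewrite (le_trans (sin_norm_le1 _))// lerDl. Qed.

Let Msin_bound (u v x : R) : `|v| = `|u| ->
  `|v * sin (u * x)| <= 1 + `|u|.
Proof.
move=> vu; rewrite normrM vu (@le_trans _ _ `|u|)// ?lerDr//.
by rewrite ler_piMr// sin_norm_le1.
Qed.

Let Mcos_bound (u : R) (x : R) : `|u * cos (u * x)| <= 1 + `|u|.
Proof.
rewrite normrM (@le_trans _ _ `|u|)// ?lerDr//.
by rewrite ler_piMr// cos_norm_le1.
Qed.

Let continuous_Mcos (u v : R) : continuous (fun x => v * cos (u * x)).
Proof. by move=> x; apply: cvgM; [exact: cvg_cst|exact: continuous_cosM]. Qed.

Let continuous_Msin (u v : R) : continuous (fun x => v * sin (u * x)).
Proof. by move=> x; apply: cvgM; [exact: cvg_cst|exact: continuous_sinM]. Qed.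

Let Rintegral_gammaZ alpha b (v : R) (T : R -> R) : 0 < alpha -> 0 < b ->
  measurable_fun setT T -> (forall x, `|T x| <= 1) ->
  \int[gamma_law alpha b]_x (v * T x) = v * \int[gamma_law alpha b]_x T x.
Proof.
move=> a0 b0 mT T1; rewrite RintegralZl//.
apply: measurable_bounded_integrable => //.
  by rewrite /= gamma_law_setT// ltry.
exists 1; split; [exact: num_real|move=> y y1 x _ /=].
by rewrite (le_trans (T1 x))// ltW.
Qed.

Lemma char_fun_gammaS alpha b (u : R) : 0 < alpha -> 0 < b ->
  char_fun (gamma_law (alpha + 1) b) u =
  char_factor b u * char_fun (gamma_law alpha b) u.
Proof.
move=> a0 b0; have a10 : 0 < alpha + 1 by rewrite ltr_wpDr.
apply: char_factorE => //.
- rewrite -(Rintegral_gammaZ (- u) a10 b0 (measurable_sinM u)); last first.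
    by move=> x; exact: sin_norm_le1.
  apply: (gamma_law_rec a0 b0 (is_derive_cosM u) (@continuous_Msin u (- u))
    (cos_bound u)).
  by move=> x; apply: Msin_bound; rewrite normrN.
- rewrite -(Rintegral_gammaZ u a10 b0 (measurable_cosM u)); last first.
    by move=> x; exact: cos_norm_le1.
  exact: (gamma_law_rec a0 b0 (is_derive_sinM u) (@continuous_Mcos u u)
    (sin_bound u) (Mcos_bound u)).
Qed.

Lemma char_fun_gamma1 b (u : R) : 0 < b ->
  char_fun (gamma_law 1 b) u = char_factor b u.
Proof.
(* The factor 1 is [cos 0 + i sin 0], the characteristic function of the point mass at 0. *)
move=> b0; rewrite -[RHS]mulr1; apply: char_factorE => //.
- rewrite -(Rintegral_gammaZ (- u) ltr01 b0 (measurable_sinM u)); last first.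
    by move=> x; exact: sin_norm_le1.
  have := gamma_law_rec1 b0 (is_derive_cosM u) (@continuous_Msin u (- u))
    (cos_bound u).
  rewrite mulr0 cos0; apply.
  by move=> x; apply: Msin_bound; rewrite normrN.
- rewrite -(Rintegral_gammaZ u ltr01 b0 (measurable_cosM u)); last first.
    by move=> x; exact: cos_norm_le1.
  have := gamma_law_rec1 b0 (is_derive_sinM u) (@continuous_Mcos u u)
    (sin_bound u) (Mcos_bound u).
  by rewrite mulr0 sin0.
Qed.

Lemma char_fun_gammaD alpha b k (u : R) : 0 < alpha -> 0 < b ->
  char_fun (gamma_law (alpha + k%:R) b) u =
  char_factor b u ^+ k * char_fun (gamma_law alpha b) u.
Proof.
move=> a0 b0; elim: k => [|k IHk]; first by rewrite addr0 expr0 mul1r.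
have ak0 : 0 < alpha + k%:R by rewrite ltr_wpDr.
rewrite -natr1 addrA; apply: (eq_trans (char_fun_gammaS u ak0 b0)).
by rewrite IHk exprS mulrA.
Qed.

Lemma char_fun_erlang k b (u : R) : 0 < b ->
  char_fun (erlang k b) u = char_factor b u ^+ k.
Proof.
move=> b0; case: k => [|k] /=.
  rewrite /char_fun /Rintegral !integral_dirac//.
  - by rewrite !mulr0 sin0 cos0 diracT !mul1e.
  - by apply/measurable_EFinP; exact: measurable_sinM.
  - by apply/measurable_EFinP; exact: measurable_cosM.
rewrite -nat1r char_fun_gammaD// char_fun_gamma1//.
by rewrite exprSr.
Qed.

End gamma_law_theory.

(** * Mixtures *)

Section mixtures.
Context {R : realType}.
Implicit Types (w : nat -> R) (K : nat -> {measure set R -> \bar R})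
  (nu : {measure set R -> \bar R}).

Lemma nneseries_EFin (u : nat -> R) (l : R) : series u @ \oo --> l ->
  (\sum_(0 <= k <oo) (u k)%:E = l%:E)%E.
Proof.
move=> ul; apply/cvg_lim => //.
under eq_fun do rewrite sumEFin.
by apply: cvg_EFin => //; exact: nearW.
Qed.

Lemma cvg_series_EFin (u : nat -> R) (l : R) : (forall k, 0 <= u k) ->
  (\sum_(0 <= k <oo) (u k)%:E = l%:E)%E -> series u @ \oo --> l.
Proof.
move=> u0 ul.
have : (\sum_(0 <= k < n) (u k)%:E)%E @[n --> \oo] --> l%:E.
  rewrite -ul; apply: is_cvg_nneseries => k _ _.
  by rewrite lee_fin.
under eq_fun do rewrite sumEFin.
by move/fine_cvg.
Qed.

Lemma ge0_integral_mixture w K nu (h : R -> \bar R) : (forall k, 0 <= w k) ->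
  is_mixture w K nu -> measurable_fun setT h -> (forall x, 0 <= h x)%E ->
  (\int[nu]_x h x = \sum_(0 <= k <oo) ((w k)%:E * \int[K k]_x h x))%E.
Proof.
move=> w0 wK mh h0.
pose m := mseries (fun k => mscale (NngNum (w0 k)) (K k)) 0.
rewrite (@eq_measure_integral _ _ _ setT m); last by move=> A mA _; exact: wK.
rewrite ge0_integral_measure_series//.
by apply: eq_eseriesr => k _; rewrite ge0_integral_mscale.
Qed.

Lemma bounded_integrable nu (h : R -> R) (M : R) : nu setT = 1%E ->
  measurable_fun setT h -> (forall x, `|h x| <= M) ->
  nu.-integrable setT (EFin \o h).
Proof.
move=> nu1 mh hM; apply: measurable_bounded_integrable => //.
  by rewrite nu1 ltry.
exists M; split; [exact: num_real|move=> y My x _ /=].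
by rewrite (le_trans (hM x))// ltW.
Qed.

Lemma integral_prob1D nu (h : R -> R) : nu setT = 1%E ->
  measurable_fun setT h -> (forall x, `|h x| <= 1) ->
  (\int[nu]_x (1 + h x)%:E = (1 + \int[nu]_x h x)%:E)%E.
Proof.
move=> nu1 mh h1; have ih := bounded_integrable nu1 mh h1.
under eq_integral do rewrite EFinD.
have i1 : nu.-integrable setT (EFin \o cst 1).
  by apply: (bounded_integrable (M := 1)) => // x; rewrite normr1.
rewrite (integralD measurableT i1 ih)//= integral_cst// nu1 mule1.
by rewrite EFinD fineK//; exact: integrable_fin_num.
Qed.

Lemma mixture_weights w K nu : (forall k, 0 <= w k) -> is_mixture w K nu ->
  (forall k, K k setT = 1%E) -> nu setT = 1%E -> series w @ \oo --> (1 : R).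
Proof.
move=> w0 wK K1 nu1; apply: cvg_series_EFin => //.
rewrite -nu1 (wK _ measurableT).
by apply: eq_eseriesr => k _; rewrite K1 mule1.
Qed.

(** The mixture formula for nonnegative integrands applies to [1 + h]; subtracting the series of
    weights, which converges to 1, leaves the series for [h]. *)
Lemma cvg_integral_mixture w K nu (h : R -> R) : (forall k, 0 <= w k) ->
  is_mixture w K nu -> (forall k, K k setT = 1%E) -> nu setT = 1%E ->
  measurable_fun setT h -> (forall x, `|h x| <= 1) ->
  series (fun k => w k * \int[K k]_x h x) @ \oo --> \int[nu]_x h x.
Proof.
move=> w0 wK K1 nu1 mh h1.
have w1 := mixture_weights w0 wK K1 nu1.
have h10 x : 0 <= 1 + h x.
  have := h1 x; rewrite ler_norml => /andP[+ _].
  by rewrite -subr_ge0 opprK addrC.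
have mh1 : measurable_fun setT (fun x => (1 + h x)%:E).
  by apply/measurable_EFinP; apply: measurable_funD.
have := ge0_integral_mixture w0 wK mh1 h10.
rewrite integral_prob1D//.
under eq_eseriesr do rewrite integral_prob1D// -EFinM.
move/esym/cvg_series_EFin => /(_ _)/wrap[].
  move=> k; rewrite mulr_ge0// -lee_fin -integral_prob1D//.
  by apply: integral_ge0 => x _; rewrite lee_fin.
move=> H; rewrite (_ : series _ = series (fun k => w k * (1 + \int[K k]_x h x))
    - series w); last first.
  apply/funext => n.
  transitivity
    (series (fun k => w k * (1 + \int[K k]_x h x)) n - series w n) => //.
  rewrite /series/= -sumrB; apply: eq_bigr => k _.
  by rewrite mulrDr mulr1 addrAC subrr add0r.
rewrite (_ : \int[nu]_x h x = 1 + \int[nu]_x h x - 1); last first.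
  by rewrite addrAC subrr add0r.
exact: cvgB H w1.
Qed.

Lemma cvg_complex (x y : nat -> R) (a b : R) : x @ \oo --> a -> y @ \oo --> b ->
  (fun n => (x n +i* y n)%C : R[i]^o) @ \oo --> ((a +i* b)%C : R[i]^o).
Proof.
move=> xa yb; apply/cvgrPdist_lt => e e0.
(* The radius [e] is an element of [R[i]]; being positive it is real, and half of its real part
   bounds each component. *)
have e_real : e \is Num.real by rewrite gtr0_real.
have eE := RRe_real e_real.
pose r := complex.Re e; have r0 : 0 < r by rewrite -ltcR eE.
have r20 : 0 < r / 2 by rewrite divr_gt0.
near=> n.
have xn : `|a - x n| < r / 2 by near: n; move/cvgrPdist_lt: xa; apply.
have yn : `|b - y n| < r / 2 by near: n; move/cvgrPdist_lt: yb; apply.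
rewrite -eE (splitr (complex.Re e)) rmorphD/=.
have -> : (a +i* b)%C - (x n +i* y n)%C =
    (a - x n)%:C%C + 'i%C * (b - y n)%:C%C.
  apply/eqP; rewrite eq_complex/= !mul0r mulr0 mul1r subr0 !addr0 !add0r.
  by rewrite !eqxx.
apply: (le_lt_trans (ler_normD _ _)).
have i1 : `|'i%C : R[i]| = 1.
  by rewrite normc_def/= expr0n/= add0r expr1n sqrtr1.
rewrite normrM i1 mul1r.
rewrite !normc_def/= expr0n/= !addr0 !sqrtr_sqr.
by apply: ltrD; rewrite ltcR.
Unshelve. all: by end_near. Qed.

Lemma cvg_regularMl (F : numFieldType) (p l : F) (f : nat -> F) :
  (f : nat -> F^o) @ \oo --> (l : F^o) ->
  ((fun n => p * f n) : nat -> F^o) @ \oo --> (p * l : F^o).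
Proof. by move=> fl; exact: (@cvgM F _ _ _ (cst p) f p l (cvg_cst p) fl). Qed.

Lemma cvg_char_fun_mixture w K nu (u : R) : (forall k, 0 <= w k) ->
  is_mixture w K nu -> (forall k, K k setT = 1%E) -> nu setT = 1%E ->
  (series (fun k => (w k)%:C%C * char_fun (K k) u : R[i]^o) @ \oo -->
    (char_fun nu u : R[i]^o)).
Proof.
move=> w0 wK K1 nu1.
have c := cvg_integral_mixture w0 wK K1 nu1 (measurable_cosM u)
  (fun x => cos_norm_le1 (u * x)).
have s := cvg_integral_mixture w0 wK K1 nu1 (measurable_sinM u)
  (fun x => sin_norm_le1 (u * x)).
apply: cvg_trans (cvg_complex c s).
apply: near_eq_cvg; apply: nearW => n.
rewrite /series/=.
elim: n => [|n IHn]; first by rewrite !big_nil.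
rewrite !big_nat_recr//= -IHn.
by apply/eqP; rewrite eq_complex/= !mul0r subr0 addr0 !eqxx.
Qed.

End mixtures.

(** * The Polya mixtures *)

Section polya_mixture.
Context {R : realType}.
Implicit Types alpha beta a : R.

Lemma polya_pmf_ge0 alpha a k : 0 < alpha -> a < 1 ->
  0 <= polya_pmf alpha (1 - a) k.
Proof.
move=> alpha0 a1; rewrite /polya_pmf /polya_binom.
rewrite mulr_ge0 ?exprn_ge0 ?subr_ge0 ?(ltW a1)// mulr_ge0 ?powR_ge0//.
rewrite mulr_ge0 ?invr_ge0//.
by apply: prodr_ge0 => i _; rewrite addr_ge0// ltW.
Qed.

(** The rising product in the Polya weight cancels against [Gamma (alpha + k)], and
    [a^alpha (beta / a)^alpha = beta^alpha]. All that still depends on [k] is the [k]-th term of an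
    exponential series. *)
Lemma polya_gamma_pdf alpha beta a (k : nat) (x : R) :
  0 < alpha -> 0 < beta -> 0 < a -> 0 < x ->
  polya_pmf alpha (1 - a) k * gamma_pdf (alpha + k%:R) (beta / a) x =
  beta `^ alpha / Gamma alpha * x `^ (alpha - 1) * expR (- (beta / a * x)) *
  exp_coeff ((1 - a) * (beta / a * x)) k.
Proof.
move=> alpha0 beta0 a0 x0; have b0 : 0 < beta / a by rewrite divr_gt0.
have ak0 : 0 < alpha + k%:R by rewrite ltr_wpDr.
rewrite (gamma_pdf_oy ak0 b0 x0) (Gamma_prod k alpha0).
rewrite /polya_pmf /polya_binom subKr /exp_coeff/= !exprMn.
have prod_neq0 : \prod_(i < k) (alpha + i%:R) != 0.
  by rewrite gt_eqF// prodr_gt0// => i _; rewrite ltr_wpDr.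
have -> : (beta / a) `^ (alpha + k%:R) = (beta / a) `^ alpha * (beta / a) ^+ k.
  by rewrite (@powRD _ _ alpha) ?(gt_eqF b0) ?implybT// powR_mulrn// ltW.
have -> : x `^ (alpha + k%:R - 1) = x `^ (alpha - 1) * x ^+ k.
  rewrite addrAC (@powRD _ x (alpha - 1)) ?(gt_eqF x0) ?implybT//.
  by rewrite powR_mulrn// ltW.
have -> : beta `^ alpha = a `^ alpha * (beta / a) `^ alpha.
  by rewrite -powRM ?(ltW a0) ?(ltW b0)// mulrC divfK// gt_eqF.
rewrite exprMn.
have f0 : k`!%:R != 0 :> R by rewrite pnatr_eq0 -lt0n fact_gt0.
have G0 : Gamma alpha != 0 by rewrite gt_eqF// Gamma_gt0.
move: prod_neq0 f0 G0.
set P := \prod_(i < k) _; set F := _`!%:R; set G := Gamma _.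
set E := expR _; set X := x `^ _; set A := a `^ _; set B := _ `^ alpha.
rewrite exprVn; set ak := a ^+ k.
have : ak != 0 by rewrite expf_neq0 ?gt_eqF.
move: ak P F G E X A B (beta ^+ k) ((1 - a) ^+ k) (x ^+ k) => ak P F G E X A B.
by move=> u v w ak0' P0 F0 G0; field; rewrite ak0' P0 F0 G0.
Qed.

Lemma gamma_pdf_polya_mixture alpha beta a (x : R) :
  0 < alpha -> 0 < beta -> 0 < a ->
  (\sum_(0 <= k <oo) (polya_pmf alpha (1 - a) k *
     gamma_pdf (alpha + k%:R) (beta / a) x)%:E = (gamma_pdf alpha beta x)%:E)%E.
Proof.
move=> alpha0 beta0 a0; have [x0|x0] := leP x 0.
  rewrite gamma_pdf_Ny0// eseries0// => k _ _.
  by rewrite gamma_pdf_Ny0// mulr0.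
apply: nneseries_EFin.
rewrite (_ : series _ = fun n =>
  beta `^ alpha / Gamma alpha * x `^ (alpha - 1) * expR (- (beta / a * x)) *
  series (exp_coeff ((1 - a) * (beta / a * x))) n); last first.
  apply/funext => n; rewrite /series/= big_distrr/=.
  by apply: eq_bigr => k _; rewrite polya_gamma_pdf.
rewrite (gamma_pdf_oy alpha0 beta0 x0).
have -> : expR (- (beta * x)) =
    expR (- (beta / a * x)) * expR ((1 - a) * (beta / a * x)).
  by rewrite -expRD; congr expR; field; rewrite gt_eqF.
rewrite !mulrA; apply: cvgM; first exact: cvg_cst.
exact: is_cvg_series_exp_coeff.
Qed.

Lemma gamma_law_polya_mixture alpha beta a :
  0 < alpha -> 0 < beta -> 0 < a -> a < 1 ->
  is_mixture (polya_pmf alpha (1 - a))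
    (fun k => gamma_law (alpha + k%:R) (beta / a))
    (gamma_law alpha beta).
Proof.
move=> alpha0 beta0 a0 a1 A mA.
rewrite /= /gamma_law.
under eq_integral do rewrite -(gamma_pdf_polya_mixture _ alpha0 beta0 a0).
rewrite integral_nneseries//.
- apply: eq_eseriesr => k _.
  under eq_integral do rewrite EFinM.
  rewrite ge0_integralZl//.
  + by apply: measurable_funTS; exact: measurable_EFin_gamma_pdf.
  + by move=> x _; rewrite lee_fin gamma_pdf_ge0.
  + by rewrite lee_fin polya_pmf_ge0.
- move=> k; apply/measurable_EFinP/measurable_funTS.
  apply: measurable_funM => //.
  exact: measurable_gamma_pdf.
- by move=> k x _; rewrite lee_fin mulr_ge0 ?polya_pmf_ge0 ?gamma_pdf_ge0.
Qed.

Lemma gamma_law_nat_setT alpha b (k : nat) : 0 < alpha -> 0 < b ->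
  gamma_law (alpha + k%:R) b setT = 1%E.
Proof. by move=> a0 b0; rewrite gamma_law_setT// ltr_wpDr. Qed.

Lemma erlang_setT (b : R) (k : nat) : 0 < b -> erlang k b setT = 1%E.
Proof.
move=> b0; case: k => [|k] /=; first by rewrite diracT.
by rewrite gamma_law_setT.
Qed.

(** Comparing total masses in the gamma mixture takes the place of the binomial series; the rate 1
    is an arbitrary choice. *)
Lemma polya_pmf_sum1 alpha a : 0 < alpha -> 0 < a -> a < 1 ->
  series (polya_pmf alpha (1 - a)) @ \oo --> (1 : R).
Proof.
move=> alpha0 a0 a1.
apply: (@mixture_weights _ _ (fun k => gamma_law (alpha + k%:R) (1 / a))
  (gamma_law alpha 1)).
- by move=> k; exact: polya_pmf_ge0.
- exact: gamma_law_polya_mixture.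
- by move=> k; apply: gamma_law_nat_setT => //; rewrite divr_gt0.
- exact: gamma_law_setT.
Qed.

Lemma ex_mixture (w : nat -> R) (K : nat -> {measure set R -> \bar R}) :
  (forall k, 0 <= w k) -> series w @ \oo --> (1 : R) ->
  (forall k, K k setT = 1%E) -> exists nu : probability R R, is_mixture w K nu.
Proof.
move=> w0 w1 K1.
pose m : {measure set R -> \bar R} :=
  mseries (fun k => mscale (NngNum (w0 k)) (K k)) 0.
have m1 : m setT = 1%E.
  rewrite -(nneseries_EFin w1); apply: eq_eseriesr => k _.
  by apply: (eq_trans (f_equal (fun t => (w k)%:E * t)%E (K1 k))); rewrite mule1.
pose P := @Measure_isProbability.Build _ _ _ (Measure.sort m) m1.
pose nu : probability R R := HB.pack (Measure.sort m) P.
by exists nu => A mA.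
Qed.

Lemma mixture_remainder alpha beta a (nu : probability R R) :
  0 < alpha -> 0 < beta -> 0 < a -> a < 1 ->
  is_mixture (polya_pmf alpha (1 - a)) (fun k => erlang k (beta / a)) nu ->
  is_remainder a (gamma_law alpha beta) nu.
Proof.
move=> alpha0 beta0 a0 a1 mix u; have b0 : 0 < beta / a by rewrite divr_gt0.
have w0 k : 0 <= polya_pmf alpha (1 - a) k by exact: polya_pmf_ge0.
have c1 := cvg_char_fun_mixture (u := u) w0
  (gamma_law_polya_mixture alpha0 beta0 a0 a1)
  (fun k => gamma_law_nat_setT k alpha0 b0) (gamma_law_setT alpha0 beta0).
have c2 := cvg_char_fun_mixture (u := u) w0 mix (fun k => erlang_setT k b0)
  (probability_setT nu).
(* By scaling this is the characteristic function of [gamma_law alpha beta] at [a * u]; it is the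
   common ratio between the terms of the series [c1] and [c2]. *)
pose phi : R[i] := char_fun (gamma_law alpha (beta / a)) u.
have c3 := @cvg_regularMl R[i] phi _ _ c2.
apply: (eq_trans _ (f_equal (fun t => t * _)
  (esym (char_fun_gamma_scale u alpha0 beta0 a0)))).
apply: (cvg_unique _ c1); first exact: norm_hausdorff.
apply: cvg_trans c3; apply: near_eq_cvg; apply: nearW => n.
rewrite /series/= big_distrr/=; apply: eq_bigr => k _.
rewrite char_fun_erlang//.
have -> := char_fun_gammaD k u alpha0 b0.
by rewrite mulrCA [phi * _]mulrC.
Qed.

Lemma polya_pmf0 alpha a : polya_pmf alpha (1 - a) 0 = a `^ alpha.
Proof.
by rewrite /polya_pmf /polya_binom big_ord0 fact0 divr1 mul1r expr0 mulr1 subKr.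
Qed.

(* [1 + cos] is nonnegative and equals [2] at the atom [0]. *)
Lemma Re_char_fun_mixture alpha a (b u : R) (nu : probability R R) :
  0 < alpha -> a < 1 ->
  is_mixture (polya_pmf alpha (1 - a)) (fun k => erlang k b) nu ->
  2 * a `^ alpha <= 1 + complex.Re (char_fun nu u).
Proof.
move=> alpha0 a1 mix.
have w0 k : 0 <= polya_pmf alpha (1 - a) k by exact: polya_pmf_ge0.
have h0 x : (0 <= (1 + cos (u * x))%:E)%E.
  by rewrite lee_fin -lerBlDl sub0r cos_geN1.
have mh : measurable_fun setT (fun x => (1 + cos (u * x))%:E).
  apply/measurable_EFinP; apply: measurable_funD => //.
  exact: measurable_cosM.
rewrite -lee_fin /= -integral_prob1D; last 3 first.
- exact: probability_setT.
- exact: measurable_cosM.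
- by move=> x; exact: cos_norm_le1.
rewrite (ge0_integral_mixture w0 mix mh h0).
apply: le_trans (nneseries_lim_ge 1 _); last first.
  by move=> k _; rewrite mule_ge0 ?lee_fin// integral_ge0.
rewrite big_nat1 polya_pmf0 /= integral_dirac// diracT mul1e mulr0 cos0.
by rewrite -EFinM lee_fin mulrC.
Qed.

(* For a ratio [a] such that [a^alpha = 3/4], the remainder has a
   characteristic function with positive real part, so a zero at [u] would
   propagate to [a^n u], which tends to [0]. *)
Lemma char_fun_gamma_neq0 alpha b (u : R) : 0 < alpha -> 0 < b ->
  char_fun (gamma_law alpha b) u != 0.
Proof.
move=> alpha0 b0; apply/eqP => phi0.
pose a : R := (3 / 4) `^ alpha^-1.
have a0 : 0 < a by rewrite powR_gt0// divr_gt0.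
have a1 : a < 1.
  have -> : (1 : R) = 1 `^ alpha^-1 by rewrite powR1.
  by apply: gt0_ltr_powR; rewrite ?invr_gt0 ?nnegrE ?divr_ge0//; lra.
have aE : a `^ alpha = 3 / 4.
  by rewrite /a -powRrM mulVf ?gt_eqF// powRr1// divr_ge0.
have ba0 : 0 < b / a by rewrite divr_gt0.
have [nu mix] := ex_mixture (fun k => polya_pmf_ge0 k alpha0 a1)
  (polya_pmf_sum1 alpha0 a0 a1) (fun k => erlang_setT k ba0).
have rem := mixture_remainder alpha0 b0 a0 a1 mix.
have phin n : char_fun (gamma_law alpha b) (a ^+ n * u) = 0.
  elim: n => [|n IHn]; first by rewrite expr0 mul1r.
  have := rem (a ^+ n * u); rewrite IHn => /esym/eqP.
  (* Either the zero passes to [a ^+ n.+1 * u], or the remainder vanishes at [a ^+ n * u], which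
     would give [2 * (3 / 4) <= 1]. *)
  rewrite mulf_eq0 mulrA -exprS => /orP[/eqP//|/eqP nu0].
  have := Re_char_fun_mixture (a ^+ n * u) alpha0 a1 mix.
  rewrite nu0 aE /= => H; exfalso; move: H.
  have : (2 * (3 / 4) : R) > 1 by lra.
  by rewrite addr0 => /lt_le_trans/[apply]; rewrite ltxx.
have law1 := gamma_law_setT alpha0 b0.
(* The real parts along [a ^+ n * u] are all 0, but dominated convergence sends them to 1, the value
   at the origin. *)
have cvg1 : (\int[gamma_law alpha b]_x (cos (a ^+ n * u * x))%:E @[n --> \oo]
    --> \int[gamma_law alpha b]_x (cst 1%E) x)%E.
  apply: (@dominated_cvg _ R R (gamma_law alpha b) setT measurableT
    (fun n x => (cos (a ^+ n * u * x))%:E) (cst 1%E) (cst 1%E)) => //.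
  - by move=> n; apply/measurable_EFinP; exact: measurable_cosM.
  - move=> x _; apply: cvg_EFin; first exact: nearW.
    have : (fun n => cos (a ^+ n * u * x)) @ \oo --> cos (0 * u * x).
      apply: (continuous_cvg _ (@continuous_cos R _)).
      apply: cvgM; last exact: cvg_cst.
      apply: cvgM; last exact: cvg_cst.
      by apply: cvg_expr; rewrite gtr0_norm.
    by rewrite !mul0r cos0.
  - by apply: (bounded_integrable (M := 1) law1) => // x; rewrite normr1.
  - by move=> n x _; rewrite /= lee_fin cos_norm_le1.
have cvg0 : (\int[gamma_law alpha b]_x (cos (a ^+ n * u * x))%:E @[n --> \oo]
    --> 0%E)%E.
  apply: cvg_near_cst; apply: nearW => n.
  have := phin n; rewrite /char_fun => -[+ _].
  (* [fine] also sends infinite values to 0, so integrability is invoked to conclude that the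
     extended integral itself is 0. *)
  rewrite /Rintegral => fine0; rewrite -[LHS]fineK ?fine0//.
  apply: integrable_fin_num => //.
  apply: (bounded_integrable (M := 1) law1); first exact: measurable_cosM.
  by move=> x; exact: cos_norm_le1.
have E1 : (\int[gamma_law alpha b]_x (cst 1%E) x = 1)%E.
  by rewrite integral_cst// mul1e; exact: law1.
rewrite E1 in cvg1.
have /eqP : (1%E = 0%E :> \bar R).
  by apply: (cvg_unique _ cvg1); [exact: ereal_hausdorff|exact: cvg0].
by rewrite onee_eq0.
Qed.

End polya_mixture.

(** * Uniqueness of the characteristic function *)

Section char_fun_uniqueness.
Context {R : realType}.
Local Notation mu := (@lebesgue_measure R).

(** The second summand of the primitive is the real part of [e^((-e + i t) v) / (-e + i t)]. *)
Lemma is_derive_damped_cos (e t x : R) : 0 < e -> is_derive x 1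
  (fun v => - (expR (- (e * v)) / e) +
            expR (- (e * v)) * (t * sin (v * t) - e * cos (v * t)) /
            (e ^+ 2 + t ^+ 2))
  (expR (- (e * x)) * (1 + cos (x * t))).
Proof.
move=> e0.
have et0 : e ^+ 2 + t ^+ 2 != 0.
  by rewrite gt_eqF// ltr_pwDl ?exprn_gt0// sqr_ge0.
apply: is_derive_eq.
rewrite /GRing.scale/=; field.
by rewrite et0 gt_eqF.
Qed.

(* The Laplace transform of [1 + cos (t x)]; the constant [1] keeps the
   integrand nonnegative, so that Tonelli applies, and the other term is the
   Poisson kernel. *)
Lemma integral_damped_cos (e t : R) : 0 < e ->
  (\int[mu]_(x in `]0%R, +oo[) (expR (- (e * x)) * (1 + cos (x * t)))%:E =
   (e^-1 + e / (e ^+ 2 + t ^+ 2))%:E)%E.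
Proof.
move=> e0.
have et0 : e ^+ 2 + t ^+ 2 != 0.
  by rewrite gt_eqF// ltr_pwDl ?exprn_gt0// sqr_ge0.
pose F v := - (expR (- (e * v)) / e) +
  expR (- (e * v)) * (t * sin (v * t) - e * cos (v * t)) / (e ^+ 2 + t ^+ 2).
have dF (x : R) : 0 < x -> is_derive x 1 F (expR (- (e * x)) * (1 + cos (x * t))).
  by move=> _; exact: is_derive_damped_cos.
rewrite (@ge0_FTC_oy _ _ F (F 0) 0 _ _ dF).
- rewrite /F !mul0r !mulr0 oppr0 expR0 sin0 cos0; congr EFin; field.
  by rewrite et0 gt_eqF.
- by move=> x _; rewrite mulr_ge0 ?expR_ge0// -lerBlDl sub0r cos_geN1.
- move=> x _; apply/differentiable_continuous/derivable1_diffP.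
  exact: ex_derive.
- apply: cvg_at_right_filter.
  have : {for (0 : R), continuous F}.
    apply/differentiable_continuous/derivable1_diffP.
    by have [] := is_derive_damped_cos t 0 e0.
  exact.
- have E0 : expR (- (e * x)) @[x --> +oo] --> (0 : R).
    have := cvg_powR_expR_y (lexx 0) e0.
    by under eq_fun do rewrite powRr0 mul1r.
  pose M := `|t| + e.
  rewrite [X in _ --> X](_ : _ = - (0 / e) + 0); last first.
    by rewrite mul0r oppr0 addr0.
  apply: cvgD.
    by apply: cvgN; apply: cvgM => //; exact: cvg_cst.
  rewrite [X in _ --> X](_ : _ = 0 / (e ^+ 2 + t ^+ 2)); last by rewrite mul0r.
  apply: cvgM; last exact: cvg_cst.
  have bound x : `|t * sin (x * t) - e * cos (x * t)| <= M.
    rewrite (le_trans (ler_normB _ _))// !normrM (gtr0_norm e0) lerD//.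
      by rewrite ler_piMr// sin_norm_le1.
    by rewrite ler_piMr ?(ltW e0)// cos_norm_le1.
  apply: (@squeeze_cvgr _ _ _ _ (fun x => expR (- (e * x)) * (- M))
    (fun x => expR (- (e * x)) * M)).
  + near=> x; have := bound x; rewrite ler_norml => /andP[T1 T2].
    by rewrite !ler_wpM2l ?expR_ge0.
  + by rewrite -(mul0r (- M)); apply: cvgM => //; exact: cvg_cst.
  + by rewrite -(mul0r M); apply: cvgM => //; exact: cvg_cst.
Unshelve. all: by end_near. Qed.

Lemma integral_poisson_kernel (e x c b : R) : 0 < e -> c < b ->
  (\int[mu]_(y in `[c, b]) (e / (e ^+ 2 + (x - y) ^+ 2))%:E =
   (atan ((b - x) / e) - atan ((c - x) / e))%:E)%E.
Proof.
move=> e0 cb.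
have ek y : e ^+ 2 + (x - y) ^+ 2 != 0.
  by rewrite gt_eqF// ltr_pwDl ?exprn_gt0// sqr_ge0.
have dF (y : R) : is_derive y 1 (fun y => atan ((y - x) / e))
    (e / (e ^+ 2 + (x - y) ^+ 2)).
  apply: is_derive_eq; rewrite /GRing.scale/=.
  have : e ^+ 2 + (y - x) ^+ 2 != 0 by rewrite -(sqrrN (y - x)) opprB ek.
  rewrite -(sqrrN (x - y)) opprB mulr0 add0r subr0 mulr1.
  by move: (y - x) => d ed; field; rewrite ed gt_eqF.
have cF : continuous (fun y => atan ((y - x) / e)).
  move=> y; apply/differentiable_continuous/derivable1_diffP.
  by have [] := dF y.
rewrite EFinB.
apply: (@continuous_FTC2 _ (fun y => e / (e ^+ 2 + (x - y) ^+ 2))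
  (fun y => atan ((y - x) / e))) => //.
- apply: continuous_subspaceT => y.
  apply/differentiable_continuous/derivable1_diffP.
  by apply: derivableM.
- split.
  + by move=> y _; have [] := dF y.
  + by apply: cvg_at_right_filter; exact: cF.
  + by apply: cvg_at_left_filter; exact: cF.
- by move=> y _; rewrite derive1E; have [_ ->] := dF y.
Qed.

Let measurable_cos : measurable_fun [set: R] cos.
Proof. exact: continuous_measurable_fun (@continuous_cos R). Qed.

Let cosB_ge0 (u x y : R) : 0 <= 1 + cos (u * (x - y)).
Proof. by rewrite -lerBlDl sub0r cos_geN1. Qed.

Section poisson.
Variable nu : probability R R.

(** [integral_damped_cos] at [t = x - y] is averaged over [x] and the integrals are exchanged by
    Tonelli; the addition formula for [cos (u (x - y))] then brings out the two components of
    [char_fun nu u]. The right-hand side depends on [nu] through its characteristic function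
    alone. *)
Lemma integral_poisson_char (e y : R) : 0 < e ->
  (\int[nu]_x (e^-1 + e / (e ^+ 2 + (x - y) ^+ 2))%:E =
   \int[mu]_(u in `]0%R, +oo[) (expR (- (e * u)) *
     (1 + cos (u * y) * complex.Re (char_fun nu u) +
      sin (u * y) * complex.Im (char_fun nu u)))%:E)%E.
Proof.
move=> e0.
pose f (z : R * measurableTypeR R) : \bar R :=
  ((expR (- (e * z.2)) * (1 + cos (z.2 * (z.1 - y))))%:E *
   (\1_`]0, +oo[ z.2)%:E)%E.
have mf : measurable_fun setT f.
  apply: emeasurable_funM; apply/measurable_EFinP.
    apply: measurable_funM.
      apply: measurableT_comp => //; apply: measurableT_comp => //.
      by apply: measurable_funM => //; exact: measurable_snd.
    apply: measurable_funD => //.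
    apply: measurableT_comp; first exact: measurable_cos.
    apply: measurable_funM; first exact: measurable_snd.
    by apply: measurable_funB => //; exact: measurable_fst.
  apply: (@measurableT_comp _ _ _ _ _ _ (\1_`]0, +oo[ : measurableTypeR R -> R)).
    exact: measurable_indic.
  exact: measurable_snd.
have f0 z : (0 <= f z)%E.
  by rewrite mule_ge0// lee_fin mulr_ge0 ?expR_ge0.
transitivity (\int[nu]_x \int[mu]_u f (x, u))%E.
  apply: eq_integral => x _; rewrite -integral_damped_cos//.
  by rewrite integral_mkcond epatch_indic.
rewrite (@fubini_tonelli _ _ R (measurableTypeR R) R nu mu f mf f0).
rewrite [RHS]integral_mkcond epatch_indic; apply: eq_integral => u _.
rewrite /f/=.
under eq_integral do rewrite EFinM -muleA [X in (_ * X)%E]muleC muleA.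
rewrite ge0_integralZl//; last first.
  apply/measurable_EFinP; apply: measurable_funD => //.
  apply: measurableT_comp; first exact: measurable_cos.
  by apply: measurable_funM => //; apply: measurable_funB.
rewrite muleAC; congr (_ * _)%E.
rewrite integral_prob1D; last 3 first.
- exact: probability_setT.
- apply: measurableT_comp; first exact: measurable_cos.
  by apply: measurable_funM => //; apply: measurable_funB.
- by move=> x; exact: cos_norm_le1.
rewrite -EFinM; congr ((_ * _)%:E); rewrite -addrA; congr (_ + _).
have ic : nu.-integrable setT (EFin \o (fun x => cos (u * x))).
  exact: bounded_integrable (probability_setT nu) (measurable_cosM u)
    (fun x => cos_norm_le1 (u * x)).
have isn : nu.-integrable setT (EFin \o (fun x => sin (u * x))).
  exact: bounded_integrable (probability_setT nu) (measurable_sinM u)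
    (fun x => sin_norm_le1 (u * x)).
have iZ (k : R) (h : R -> R) : nu.-integrable setT (EFin \o h) ->
    nu.-integrable setT (EFin \o (fun x => k * h x)).
  by move=> ih; exact: (integrableZl measurableT k ih).
rewrite /= -!RintegralZl// -RintegralD//; last 2 first.
- exact: iZ.
- exact: iZ.
apply: eq_Rintegral => x _; rewrite mulrBr cosB.
by rewrite mulrC [sin _ * _]mulrC.
Qed.

(** Tonelli again, now in [x] and [y]: over [[c, b]] the constant [1 / e] contributes [(b - c) / e]
    and the Poisson kernel the difference of arctangents. *)
Lemma integral_poisson_interval (e c b : R) : 0 < e -> c < b ->
  (\int[nu]_x ((b - c) / e + (atan ((b - x) / e) - atan ((c - x) / e)))%:E =
   \int[mu]_(y in `[c, b]) \int[nu]_x (e^-1 + e / (e ^+ 2 + (x - y) ^+ 2))%:E)%E.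
Proof.
move=> e0 cb.
have k0 (x y : R) : 0 <= e / (e ^+ 2 + (x - y) ^+ 2).
  by rewrite divr_ge0 ?(ltW e0)// addr_ge0 ?sqr_ge0.
have ek (z : R) : e ^+ 2 + z ^+ 2 != 0.
  by rewrite gt_eqF// ltr_pwDl ?exprn_gt0// sqr_ge0.
have mk : measurable_fun setT (fun z : R => e / (e ^+ 2 + z ^+ 2)).
  apply: continuous_measurable_fun => z.
  apply/differentiable_continuous/derivable1_diffP.
  by apply: derivableM => //; apply: derivableV.
pose f (z : R * measurableTypeR R) : \bar R :=
  ((e^-1 + e / (e ^+ 2 + (z.1 - z.2) ^+ 2))%:E * (\1_`[c, b] z.2)%:E)%E.
have mf : measurable_fun setT f.
  apply: emeasurable_funM; apply/measurable_EFinP.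
    apply: measurable_funD => //.
    apply: (measurableT_comp mk); apply: measurable_funB.
      exact: measurable_fst.
    exact: measurable_snd.
  apply: (@measurableT_comp _ _ _ _ _ _ (\1_`[c, b] : measurableTypeR R -> R)).
    exact: measurable_indic.
  exact: measurable_snd.
have f0 z : (0 <= f z)%E.
  by rewrite mule_ge0// lee_fin addr_ge0// invr_ge0 ltW.
transitivity (\int[nu]_x \int[mu]_y f (x, y))%E.
  apply: eq_integral => x _.
  transitivity
      (\int[mu]_(y in `[c, b]) (e^-1 + e / (e ^+ 2 + (x - y) ^+ 2))%:E)%E.
    under [RHS]eq_integral do rewrite EFinD.
    rewrite ge0_integralD//=; last 3 first.
    - by move=> y _; rewrite lee_fin invr_ge0 ltW.
    - by move=> y _; rewrite lee_fin.
    - apply/measurable_EFinP/measurable_funTS/(measurableT_comp mk).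
      exact: measurable_funB.
    rewrite integral_poisson_kernel// integral_cst//= lebesgue_measure_itv/=.
    by rewrite lte_fin cb -EFinB -EFinM -EFinD mulrC.
  by rewrite integral_mkcond epatch_indic.
rewrite (@fubini_tonelli _ _ R (measurableTypeR R) R nu mu f mf f0).
rewrite [RHS]integral_mkcond epatch_indic; apply: eq_integral => y _.
rewrite /f/= -ge0_integralZr//.
- apply/measurable_EFinP; apply: measurable_funD => //.
  by apply: (measurableT_comp mk); exact: measurable_funB.
- by move=> x _; rewrite lee_fin addr_ge0// invr_ge0 ltW.
Qed.

End poisson.

(* [step n (s - x)] is [(s + v - x) / v ^+ 2] for [v = n.+1%:R^-1]: the Poisson
   scale [v ^+ 2] shrinks faster than the shift [v] of the endpoint, so that
   the endpoint [s] itself falls on the left in the limit. *)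
Let step (n : nat) (s : R) : R := n.+1%:R * (n.+1%:R * s + 1).

(** For [s >= 0], even [s = 0], the summand 1 in [step] gives [step n s >= n + 1]; for [s < 0] the
    quadratic term wins and [step n s] tends to minus infinity. *)
Lemma cvg_atan_step (s : R) :
  atan (step n s) @[n --> \oo] --> (if 0 <= s then pi / 2 else - (pi / 2) : R).
Proof.
case: ifPn => [s0|]; last rewrite -ltNge => s0.
  apply: (cvg_comp _ _ _ (@cvgy_atan R)).
  apply/cvgryPge => A; near=> n.
  rewrite (@le_trans _ _ n%:R)//; first by near: n; exact: nbhs_infty_ger.
  by rewrite /step (@le_trans _ _ n.+1%:R) ?ler_nat// ler_peMr// lerDr mulr_ge0.
rewrite -[X in X @ _ --> _](_ : (fun n => - atan (- step n s)) = _); last first.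
  by apply/funext => n; rewrite atanN opprK.
apply: cvgN; apply: (cvg_comp _ _ _ (@cvgy_atan R)).
apply/cvgryPge => A; near=> n.
rewrite (@le_trans _ _ n%:R)//; first by near: n; exact: nbhs_infty_ger.
rewrite /step -mulrN (@le_trans _ _ n.+1%:R) ?ler_nat// ler_peMr//.
(* From [n (- s) >= 2] the inner factor [(n + 1) s + 1] is at most -1. *)
have : 2 / (- s) <= n%:R by near: n; exact: nbhs_infty_ger.
rewrite ler_pdivrMr ?oppr_gt0// => H.
have : n%:R * - s <= n.+1%:R * - s by rewrite ler_wpM2r ?ler_nat// oppr_ge0 ltW.
by move=> H2; lra.
Unshelve. all: by end_near. Qed.

Lemma char_fun_atan (nu1 nu2 : probability R R) (e c b : R) :
  char_fun nu1 =1 char_fun nu2 -> 0 < e -> c < b ->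
  (\int[nu1]_x (atan ((b - x) / e) - atan ((c - x) / e))%:E =
   \int[nu2]_x (atan ((b - x) / e) - atan ((c - x) / e))%:E)%E.
Proof.
move=> nu12 e0 cb; pose h (x : R) := atan ((b - x) / e) - atan ((c - x) / e).
have mh : measurable_fun setT h.
  apply: continuous_measurable_fun => x.
  apply/differentiable_continuous/derivable1_diffP.
  by apply: derivableB; exact: ex_derive.
have h_bound x : `|h x| <= pi.
  have := atan_ltpi2 ((b - x) / e); have := atan_gtNpi2 ((b - x) / e).
  have := atan_ltpi2 ((c - x) / e); have := atan_gtNpi2 ((c - x) / e).
  by rewrite ler_norml /h => H1 H2 H3 H4; apply/andP; split; lra.
have ih (nu : probability R R) : nu.-integrable setT (EFin \o h).
  exact: bounded_integrable (probability_setT nu) mh h_bound.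
(* The constant has the same finite integral under every probability, so it cancels between [nu1]
   and [nu2]. *)
have split_int (nu : probability R R) :
    (\int[nu]_x ((b - c) / e + h x)%:E =
     ((b - c) / e)%:E + \int[nu]_x (h x)%:E)%E.
  under eq_integral do rewrite EFinD.
  rewrite (integralD measurableT _ (ih nu))//=.
    by rewrite integral_cst// [X in (_ * X)%E]probability_setT mule1.
  by apply: (bounded_integrable (M := `|(b - c) / e|) (probability_setT nu)).
have : (\int[nu1]_x ((b - c) / e + h x)%:E =
        \int[nu2]_x ((b - c) / e + h x)%:E)%E.
  rewrite !integral_poisson_interval//; apply: eq_integral => y _.
  rewrite !integral_poisson_char//; apply: eq_integral => u _.
  by rewrite nu12.
rewrite !split_int => /(congr1 (fun t => t - ((b - c) / e)%:E)%E).
by rewrite ![(((b - c) / e)%:E + _)%E]addeC !addeK.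
Qed.

Lemma char_fun_ocitv (nu1 nu2 : probability R R) (c b : R) :
  char_fun nu1 =1 char_fun nu2 -> c < b ->
  nu1 `]c, b]%classic = nu2 `]c, b]%classic.
Proof.
move=> nu12 cb.
have lim (nu : probability R R) :
    (\int[nu]_x (atan (step n (b - x)) - atan (step n (c - x)))%:E)%E @[n --> \oo]
    --> (pi%:E * nu `]c, b]%classic)%E.
  have -> : (pi%:E * nu `]c, b]%classic = \int[nu]_x (pi * \1_`]c, b] x)%:E)%E.
    under eq_integral do rewrite EFinM.
    rewrite ge0_integralZl//.
    - by rewrite integral_indic// setIT.
    - exact/measurable_EFinP.
    - by rewrite lee_fin pi_ge0.
  apply: (@dominated_cvg _ R R nu setT measurableT
    (fun n x => (atan (step n (b - x)) - atan (step n (c - x)))%:E) _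
    (cst pi%:E)) => //.
  - move=> n; apply/measurable_EFinP; apply: continuous_measurable_fun => x.
    apply/differentiable_continuous/derivable1_diffP.
    by apply: derivableB; exact: ex_derive.
  - move=> x _; apply: cvg_EFin; first exact: nearW.
    (* The two limits differ exactly when [c < x <= b]: the value of the limit at 0 decides which
       endpoint is included. *)
    have -> : pi * \1_`]c, b] x = (if 0 <= b - x then pi / 2 else - (pi / 2)) -
        (if 0 <= c - x then pi / 2 else - (pi / 2)) :> R.
      rewrite indicE mem_setE in_itv/= !subr_ge0 ltNge.
      by case: (leP x c) => [xc|cx]; case: (leP x b) => [xb|bx] /=;
        rewrite ?mulr0 ?mulr1; lra.
    by apply: cvgB; exact: cvg_atan_step.
  - by apply: (bounded_integrable (M := pi) (probability_setT nu)) => // x;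
      rewrite ger0_norm// pi_ge0.
  - move=> n x _; rewrite /= lee_fin.
    have := atan_ltpi2 (step n (b - x)); have := atan_gtNpi2 (step n (b - x)).
    have := atan_ltpi2 (step n (c - x)); have := atan_gtNpi2 (step n (c - x)).
    by rewrite ler_norml => H1 H2 H3 H4; apply/andP; split; lra.
(* This is the argument of the arctangent in [char_fun_atan] for scale [(n + 1)^-2] and both
   endpoints shifted by [1 / (n + 1)]. *)
have stepE n (s x : R) : step n (s - x) =
    (s + n.+1%:R^-1 - x) / (n.+1%:R ^- 2).
  rewrite /step; have : n.+1%:R != 0 :> R by rewrite pnatr_eq0.
  by move: (n.+1%:R : R) => t t0; field.
have : (pi%:E * nu1 `]c, b]%classic = pi%:E * nu2 `]c, b]%classic)%E.
  apply: (cvg_unique _ (lim nu1)); first exact: ereal_hausdorff.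
  apply: cvg_trans (lim nu2); apply: near_eq_cvg; apply: nearW => n.
  under [LHS]eq_integral do rewrite !stepE.
  under [RHS]eq_integral do rewrite !stepE.
  by apply: char_fun_atan; rewrite ?invr_gt0 ?exprn_gt0 ?ltrD2r// => u; rewrite nu12.
move=> /(congr1 (fun t => (pi^-1)%:E * t)%E).
by rewrite !muleA -!EFinM mulVf ?mul1e// gt_eqF// pi_gt0.
Qed.

(** Half-open intervals are stable under intersection and generate the Borel sets, and countably
    many of finite mass cover the line. *)
Lemma char_fun_inj (nu1 nu2 : probability R R) :
  char_fun nu1 =1 char_fun nu2 ->
  forall A, measurable A -> nu1 A = nu2 A.
Proof.
move=> nu12 A mA; rewrite -!measure_toRE.
apply: (measure_unique (@ocitv R) (fun k => `]- k%:R, k%:R]%classic)) => //.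
- exact: ocitvI.
- by move=> k; exact: is_ocitv.
- exact: bigcup_itvT.
- move=> _ [[c b] _ <-] /=.
  have [cb|bc] := ltP c b; first exact: char_fun_ocitv.
  by rewrite set_itv_ge ?measure0// bnd_simp -leNgt.
- by move=> k /=; rewrite (le_lt_trans (probability_le1 _ _))// ltry.
Qed.

End char_fun_uniqueness.

(** * The generalized density *)

Section remainder_density.
Context {R : realType}.
Variables alpha beta a : R.
Hypotheses (alpha_gt0 : 0 < alpha) (beta_gt0 : 0 < beta)
  (a_gt0 : 0 < a) (a_lt1 : a < 1).

Let b_gt0 : 0 < beta / a. Proof. by rewrite divr_gt0. Qed.

Let w k := polya_pmf alpha (1 - a) k.

Let w_ge0 k : 0 <= w k. Proof. exact: polya_pmf_ge0. Qed.

(** The partial sums of the weights increase to 1. The bound lets the series of densities be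
    compared with an exponential series. *)
Let w_le1 k : w k <= 1.
Proof.
have w1 : series w @ \oo --> (1 : R) by exact: polya_pmf_sum1.
have nd : nondecreasing_seq (series w).
  apply/nondecreasing_seqP => n; rewrite /series/= big_nat_recr//=.
  by rewrite lerDl.
apply: (@le_trans _ _ (series w k.+1)).
  by rewrite /series/= big_nat_recr//= lerDr sumr_ge0.
rewrite -(cvg_lim _ w1)//; apply: nondecreasing_cvgn_le => //.
by apply/cvg_ex; exists 1.
Qed.

(** Index [k] stands for shape [k + 1], shape 0 being the atom. The limit is a genuine one by
    [is_cvg_remainder_density]. *)
Definition remainder_density (x : R) : R :=
  limn (series (fun k => w k.+1 * gamma_pdf k.+1%:R (beta / a) x)).

Lemma is_cvg_remainder_density (x : R) :
  cvgn (series (fun k => w k.+1 * gamma_pdf k.+1%:R (beta / a) x)).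
Proof.
have [x0|x0] := leP x 0.
  rewrite (_ : series _ = cst 0); first exact: is_cvg_cst.
  apply/funext => n; rewrite /series/= big1// => k _.
  by rewrite gamma_pdf_Ny0// mulr0.
pose c := (beta / a) * x; pose C := (beta / a) * expR (- c).
(* The Erlang density of shape [k + 1] and rate [b] is [b e^(-b x) (b x)^k / k!], since
   [Gamma (k + 1) = k!]. *)
have pdfE k : gamma_pdf k.+1%:R (beta / a) x = C * exp_coeff c k.
  rewrite (gamma_pdf_oy _ b_gt0 x0)//.
  rewrite -[in Gamma _]nat1r (Gamma_prod _ ltr01) Gamma1 mulr1.
  have -> : \prod_(i < k) (1 + i%:R) = k`!%:R :> R.
    rewrite fact_prod natr_prod big_add1/= big_mkord.
    by apply: eq_bigr => i _; rewrite nat1r.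
  rewrite powR_mulrn ?(ltW b_gt0)// -natr1 addrK powR_mulrn ?(ltW x0)//.
  have f0 : k`!%:R != 0 :> R by rewrite pnatr_eq0 -lt0n fact_gt0.
  have alg (u v y F : R) : F != 0 ->
      u ^+ k.+1 / F * (y ^+ k * v) = u * v * ((u * y) ^+ k / F).
    by move=> F0; rewrite exprMn exprS; field.
  exact: alg.
apply: (@series_le_cvg _ _ (fun k => C * exp_coeff c k)).
- by move=> k; rewrite mulr_ge0 ?gamma_pdf_ge0.
- by move=> k; rewrite -pdfE gamma_pdf_ge0.
- by move=> k; rewrite -pdfE ler_piMl ?gamma_pdf_ge0.
rewrite (_ : series _ = fun n => C * series (exp_coeff c) n); last first.
  by apply/funext => n; rewrite /series/= big_distrr.
by apply: is_cvgMr; exact: is_cvg_series_exp_coeff.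
Qed.

Lemma remainder_densityE (x : R) :
  (\sum_(0 <= k <oo) (w k.+1 * gamma_pdf k.+1%:R (beta / a) x)%:E =
   (remainder_density x)%:E)%E.
Proof. by apply: nneseries_EFin; exact: is_cvg_remainder_density. Qed.

Lemma remainder_density_Ny0 (x : R) : x <= 0 -> remainder_density x = 0.
Proof.
move=> x0; apply/cvg_lim => //; rewrite (_ : series _ = cst 0); first exact: cvg_cst.
apply/funext => n; rewrite /series/= big1// => k _.
by rewrite gamma_pdf_Ny0// mulr0.
Qed.

Lemma cvg_remainder_density (x : R) :
  (fun n : nat => \sum_(1 <= k < n) w k * gamma_pdf k%:R (beta / a) x) @ \oo -->
  remainder_density x.
Proof.
rewrite -cvg_shiftS; apply: cvg_trans (is_cvg_remainder_density (x := x)).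
apply: near_eq_cvg; apply: nearW => n.
by rewrite /series/= big_add1.
Qed.

Lemma remainder_generalized_density (nu : {measure set R -> \bar R}) :
  is_mixture w (fun k => erlang k (beta / a)) nu ->
  has_generalized_density nu (a `^ alpha) remainder_density.
Proof.
have t_ge0 k x : 0 <= w k.+1 * gamma_pdf k.+1%:R (beta / a) x.
  by rewrite mulr_ge0 ?gamma_pdf_ge0.
have mt k : measurable_fun setT
    (fun x => w k.+1 * gamma_pdf k.+1%:R (beta / a) x).
  by apply: measurable_funM => //; exact: measurable_gamma_pdf.
move=> mix; split.
- apply: (measurable_fun_cvg (h := fun n x =>
    series (fun k => w k.+1 * gamma_pdf k.+1%:R (beta / a) x) n)).
    by move=> n; apply: measurable_sum.
  by move=> x _; exact: is_cvg_remainder_density.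
- move=> x; apply: limr_ge; first exact: is_cvg_remainder_density.
  by apply: nearW => n; exact: sumr_ge0.
- move=> A mA; rewrite mix//.
  (* The term [k = 0] is the atom, of mass [w 0 = a^alpha]; the remaining terms are integrated one
     by one. *)
  rewrite (nneseries_split 0 1)//; last first.
    by move=> k _; rewrite mule_ge0 ?lee_fin.
  rewrite big_nat1 [w 0]polya_pmf0; congr (_ + _)%E.
  under [RHS]eq_integral do rewrite -remainder_densityE.
  rewrite integral_nneseries//; last 2 first.
  + by move=> k; apply/measurable_EFinP; exact: (measurable_funTS (mt k)).
  + by move=> k x _; rewrite lee_fin.
  rewrite -nneseries_addn; last by move=> k; rewrite mule_ge0 ?lee_fin.
  apply: eq_eseriesr => k _.
  under [RHS]eq_integral do rewrite EFinM.
  rewrite ge0_integralZl//.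
  + by rewrite add0n addn1.
  + by apply: measurable_funTS; exact: measurable_EFin_gamma_pdf.
  + by move=> x _; rewrite lee_fin gamma_pdf_ge0.
  + by rewrite lee_fin.
Qed.

End remainder_density.

(** A remainder is specified by its functional equation, so the conclusions concern every law
    satisfying it; the existence clause keeps them from being vacuous. *)
Theorem theorem2p4 (R : realType) (alpha beta a : R)
    (alpha_gt0 : 0 < alpha) (beta_gt0 : 0 < beta)
    (a_gt0 : 0 < a) (a_lt1 : a < 1) :
  (exists nu : probability R R, is_remainder a (gamma_law alpha beta) nu) /\
  (forall nu : probability R R, is_remainder a (gamma_law alpha beta) nu ->
    [/\ is_mixture (polya_pmf alpha (1 - a)) (fun k => erlang k (beta / a)) nu,
        forall u : R,
          (series (fun k : nat =>
             (polya_binom alpha k * a `^ alpha * (1 - a) ^+ k)%:C%C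
             * (beta%:C%C / (beta%:C%C - 'i%C * (a * u)%:C%C)) ^+ k : R[i]^o)
             @ \oo --> (char_fun nu u : R[i]^o)) &
        exists g : R -> R,
          [/\ forall x : R,
                (fun n : nat => \sum_(1 <= k < n)
                   polya_binom alpha k * a `^ alpha * (1 - a) ^+ k
                   * gamma_pdf k%:R (beta / a) x) @ \oo --> g x,
              forall x : R, x <= 0 -> g x = 0 &
              has_generalized_density nu (a `^ alpha) g]]).
Proof.
have b_gt0 : 0 < beta / a by rewrite divr_gt0.
have w_ge0 k : 0 <= polya_pmf alpha (1 - a) k by exact: polya_pmf_ge0.
have wE k : polya_binom alpha k * a `^ alpha * (1 - a) ^+ k =
    polya_pmf alpha (1 - a) k by rewrite /polya_pmf subKr.
have [nu0 mix0] := ex_mixture w_ge0 (polya_pmf_sum1 alpha_gt0 a_gt0 a_lt1)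
  (fun k => erlang_setT k b_gt0).
have rem0 := mixture_remainder alpha_gt0 beta_gt0 a_gt0 a_lt1 mix0.
split; first by exists nu0.
move=> nu rem.
have nuE : char_fun nu =1 char_fun nu0.
  move=> u; have := rem u; rewrite (rem0 u) => /esym; apply: mulfI.
  exact: char_fun_gamma_neq0.
have mix : is_mixture (polya_pmf alpha (1 - a))
    (fun k => erlang k (beta / a)) nu.
  by move=> A mA; apply: (eq_trans (char_fun_inj nuE mA)); exact: mix0.
split=> //.
- move=> u.
  have c := cvg_char_fun_mixture (u := u) w_ge0 mix
    (fun k => erlang_setT k b_gt0)
    (probability_setT nu).
  apply: cvg_trans c; apply: near_eq_cvg; apply: nearW => n.
  rewrite /series/=; apply: eq_bigr => k _; rewrite wE.
  apply: (f_equal (fun t => _ * t)); apply: (eq_trans (char_fun_erlang k u b_gt0)).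
  (* The factor of rate [beta] at [a * u] is that of rate [beta / a] at [u]. *)
  by rewrite -char_factor_scale.
- exists (remainder_density alpha beta a); split.
  + move=> x; under eq_fun do under eq_bigr do rewrite wE.
    exact: cvg_remainder_density.
  + exact: remainder_density_Ny0.
  + exact: remainder_generalized_density.
Qed.
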